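(* (a) For any permutative block code $h\in\mathcal F(\kappa,\ell)$, there exists a regular Toeplitz subshift $Y\subseteq\mathcal A_\kappa^{\mathbb Z}$ such that $\eta_h^{-1}(Y)$ is strictly ergodic. (b) For any permutative block code $h\in\mathcal F(\kappa,\ell)$, there exists a regular Toeplitz subshift $Y\subseteq\mathcal A_\kappa^{\mathbb Z}$ such that $\eta_h^{-1}(Y)$ is not minimal. (c) For any Toeplitz subshift $Y\subseteq\mathcal A_\kappa^{\mathbb Z}$, there exists a permutative block code $h\in\mathcal F(\kappa,\ell)$, for some $\ell\in\mathbb N$, such that $\eta_h^{-1}(Y)$ is not minimal. (d) There exist a regular Toeplitz subshift $Y\subseteq\mathcal A_\kappa^{\mathbb Z}$ and a permutative block code $h\in\mathcal F(\kappa,\ell)$, for some $\kappa,\ell\in\mathbb N$, such that $\eta_h^{-1}(Y)$ is minimal, but not uniquely ergodic.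
   Context: $\mathbb N=\{1,2,\dots\}$, $\kappa,\ell\in\mathbb N$, $\mathcal A_\kappa=\{0,\dots,\kappa-1\}$, $x_{[k,n]}=x_k\ldots x_n$. $\mathcal A_\kappa^{\mathbb Z}$ carries the product topology; $\sigma$ is the left shift, $\sigma(x)_n=x_{n+1}$. A subshift is a closed $\sigma$-invariant subset. A system is minimal if all orbits are dense, uniquely ergodic if it has exactly one invariant Borel probability measure, and strictly ergodic if both. A block code of length $\ell$ is a map $h:\mathcal A_\kappa^\ell\to\mathcal A_\kappa$; the set of these is $\mathcal F(\kappa,\ell)$. The sliding block code $\eta_h:\mathcal A_\kappa^{\mathbb Z}\to\mathcal A_\kappa^{\mathbb Z}$ is $\eta_h(x)_n=h(x_{[n,n+\ell-1]})$. $h$ is permutative if for every $u\in\mathcal A_\kappa^{\ell-1}$ both maps $a\mapsto h(ua)$ and $a\mapsto h(au)$ are permutations of $\mathcal A_\kappa$. In all four parts the block code and the Toeplitz subshift share the same alphabet $\mathcal A_\kappa$. Toeplitz notions: $\xi\in\mathcal A_\kappa^{\mathbb Z}$ is a Toeplitz sequence if it is not periodic and for every $n\in\mathbb Z$ there is $p\in\mathbb N$ with $\xi_{n+pk}=\xi_n$ for all $k\in\mathbb Z$. Put $\mathrm{Per}(\xi,p,a)=\{n\in\mathbb Z\mid\xi_{n+kp}=a\ \forall k\in\mathbb Z\}$ and $\mathrm{Per}(\xi,p)=\bigcup_{a\in\mathcal A_\kappa}\mathrm{Per}(\xi,p,a)$. $p$ is an essential period of $\xi$ if $\mathrm{Per}(\xi,p)\ne\varnothing$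 and there is no $q<p$ with $\mathrm{Per}(\xi,p,a)\subseteq\mathrm{Per}(\xi,q,a)$ for all $a\in\mathcal A_\kappa$. A period structure of $\xi$ is a strictly increasing sequence $(p_k)_{k\in\mathbb N}$ of essential periods of $\xi$ with $p_k\mid p_{k+1}$ and $\bigcup_k\mathrm{Per}(\xi,p_k)=\mathbb Z$. $\xi$ is regular if $\lim_{k\to\infty}\#(\mathrm{Per}(\xi,p_k)\cap[0,p_k-1])/p_k=1$ for a period structure $(p_k)$ of $\xi$ (this does not depend on the period structure). A Toeplitz subshift is the subshift $X_\xi=\{x\in\mathcal A_\kappa^{\mathbb Z}\mid\text{every finite word occurring in }x\text{ occurs in }\xi\}$ of a Toeplitz sequence $\xi$; it is regular if it contains a regular Toeplitz sequence.
   Formalization: Parts (a) and (b) are stated for κ ≥ 2, since over one letter no Toeplitz sequence exists; part (b) is stated for ℓ ≥ 2, since for ℓ = 1 the map η_h is a conjugacy and η_h^{-1}(Y) is always minimal. *)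

(* Defs.v *)
From HB Require Import structures.
From mathcomp Require Import all_boot all_order all_algebra.
From mathcomp Require Import all_classical all_reals all_analysis.

Set Implicit Arguments.
Unset Strict Implicit.
Unset Printing Implicit Defensive.

Import Order.TTheory GRing.Theory Num.Theory.
Import numFieldNormedType.Exports.

Local Open Scope classical_set_scope.
Local Open Scope ring_scope.

(* The alphabet with kappa letters is 'I_kappa; the space of bi-infinite
   sequences carries the product of the discrete topologies. *)
Definition config (kappa : nat) : Type :=
  prod_topology (fun _ : int => discrete_topology 'I_kappa).

HB.instance Definition _ (kappa : nat) := Uniform.on (config kappa).

(* A measurableType must be pointed, so the alphabet has to be nonempty as soon
   as measures are involved. *)
HB.instance Definition _ (k : nat) := isPointed.Build 'I_k.+1 ord0.

HB.instance Definition _ (k : nat) := Pointed.on (config k.+1).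

(* x_[n, n + m - 1] *)
Definition window (kappa : nat) (x : config kappa) (n : int) (m : nat) :
    m.-tuple 'I_kappa :=
  [tuple x (n + i%:Z) | i < m].

(* The m-th iterate of the left shift, m of either sign. *)
Definition shift_iter (kappa : nat) (m : int) (x : config kappa) :
    config kappa :=
  fun n => x (n + m).

Definition shift (kappa : nat) (x : config kappa) : config kappa :=
  shift_iter 1 x.

Definition orbit (kappa : nat) (x : config kappa) : set (config kappa) :=
  range (fun m : int => shift_iter m x).

Definition minimal (kappa : nat) (X : set (config kappa)) : Prop :=
  forall x, X x -> X `<=` closure (orbit x).

Notation borel_config k := (g_sigma_algebraType (@open (config k.+1))).

(* Borel probability measures on X are viewed as Borel probability measures on
   the full shift giving mass 1 to X. *)
Definition invariant_probability (R : realType) (k : nat)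
    (X : set (config k.+1)) (mu : probability (borel_config k) R) : Prop :=
  mu X = 1%E /\
  forall A : set (borel_config k), measurable A ->
    mu (@shift k.+1 @^-1` A) = mu A.

Definition uniquely_ergodic (R : realType) (k : nat)
    (X : set (config k.+1)) : Prop :=
  exists2 mu : probability (borel_config k) R,
    invariant_probability X mu &
    forall nu : probability (borel_config k) R,
      invariant_probability X nu ->
      forall A : set (borel_config k), measurable A -> nu A = mu A.

Definition strictly_ergodic (R : realType) (k : nat)
    (X : set (config k.+1)) : Prop :=
  minimal X /\ uniquely_ergodic R X.

Definition block_code (kappa ell : nat) : Type :=
  ell.-tuple 'I_kappa -> 'I_kappa.

Definition sliding_block_code (kappa ell : nat) (h : block_code kappa ell)
    (x : config kappa) : config kappa :=
  fun n => h (window x n ell).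

(* The length is l.+1, so that words of length one less are l-tuples. *)
Definition permutative (kappa l : nat) (h : block_code kappa l.+1) : Prop :=
  forall u : l.-tuple 'I_kappa,
    bijective (fun a : 'I_kappa => h [tuple of rcons u a]) /\
    bijective (fun a : 'I_kappa => h [tuple of a :: u]).

Definition periodic (kappa : nat) (x : config kappa) : Prop :=
  exists2 p : nat, (0 < p)%N & forall n : int, x (n + p%:Z) = x n.

Definition toeplitz (kappa : nat) (xi : config kappa) : Prop :=
  ~ periodic xi /\
  forall n : int, exists2 p : nat, (0 < p)%N &
    forall k : int, xi (n + p%:Z * k) = xi n.

Definition Per_letter (kappa : nat) (xi : config kappa) (p : nat)
    (a : 'I_kappa) : set int :=
  [set n | forall k : int, xi (n + k * p%:Z) = a].

Definition Per (kappa : nat) (xi : config kappa) (p : nat) : set int :=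
  \bigcup_a Per_letter xi p a.

Definition essential_period (kappa : nat) (xi : config kappa) (p : nat) :
    Prop :=
  [/\ (0 < p)%N, Per xi p !=set0 &
    ~ exists2 q : nat, (0 < q < p)%N &
        forall a : 'I_kappa, Per_letter xi p a `<=` Per_letter xi q a].

Definition period_structure (kappa : nat) (xi : config kappa)
    (p : nat -> nat) : Prop :=
  [/\ forall k, (p k < p k.+1)%N,
      forall k, essential_period xi (p k),
      forall k, (p k %| p k.+1)%N &
      \bigcup_k Per xi (p k) = setT].

Definition regular (R : realType) (kappa : nat) (xi : config kappa) : Prop :=
  exists2 p : nat -> nat, period_structure xi p &
    (fun k => #|[pred i : 'I_(p k) | (i : nat)%:Z \in Per xi (p k)]|%:R
                / (p k)%:R : R) @ \oo --> (1 : R).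

Definition occurs (kappa m : nat) (w : m.-tuple 'I_kappa) (x : config kappa) :
    Prop :=
  exists n : int, window x n m = w.

Definition language_subshift (kappa : nat) (xi : config kappa) :
    set (config kappa) :=
  [set x | forall (m : nat) (w : m.-tuple 'I_kappa), occurs w x -> occurs w xi].

Definition toeplitz_subshift (kappa : nat) (Y : set (config kappa)) : Prop :=
  exists2 xi : config kappa, toeplitz xi & Y = language_subshift xi.

Definition regular_toeplitz_subshift (R : realType) (kappa : nat)
    (Y : set (config kappa)) : Prop :=
  toeplitz_subshift Y /\
  exists x : config kappa, [/\ Y x, toeplitz x & regular R x].

(* Main.v *)
Require Import Defs.
From HB Require Import structures.
From mathcomp Require Import all_boot all_order all_algebra fingroup perm.
From mathcomp Require Import all_classical all_reals all_analysis.
From mathcomp Require Import measurable_realfun.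
From mathcomp Require Import zify ring lra.

Set Implicit Arguments.
Unset Strict Implicit.
Unset Printing Implicit Defensive.

Import Order.TTheory GRing.Theory Num.Theory.
Import numFieldNormedType.Exports.

Local Open Scope classical_set_scope.
Local Open Scope ring_scope.

(** For a permutative code h of length l + 1, a preimage x of y is determined by y
    and by one window of length l of x, its state: reading the letter y i moves
    the state at i to the state at i + 1 by a permutation [step (y i)]. So the
    preimage of a subshift Y is a skew product over Y with finite fibre, and the
    four claims are about how the words of Y act on the states.

    All examples come from Toeplitz sequences with one hole per period
    ([fills_holes]): the word W n between two holes of level n gives
    W (n+1) = W n, a 1, W n, a 2, ..., W n, where the letters a i form a word s n
    of our choice. Such a sequence is regular, because only one residue class
    modulo its n-th period is not periodic; the same criterion
    ([toeplitz_regular_run]) serves for runs of bounded length. If each s n acts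
    as the identity on states then so does each W n, and the states at the holes
    of level n are driven by the letters in those holes
    ([level_state_step]). If moreover the prefixes of s n carry every state to
    every other state, then each preimage attains all states at level n within
    one period of level n + 1, and the preimage of Y is minimal
    ([preimage_minimal]). Words s n of this kind exist for every permutative h,
    since the permutations [step a] generate a transitive group
    ([covering_word]).

    Strict ergodicity: take the same word s at all levels. Two blocks of level
    n + 1 both contain a block of level n in one fixed state, so the difference
    of their visit counts to a clopen set grows by a smaller factor than the
    period, and visit frequencies converge uniformly ([visits_bounds]). An
    invariant measure exists by compactness ([krylov_bogoliubov]), where the
    measure is extended from the algebra of clopen sets ([extend_local]).

    Minimality without unique ergodicity: for the sum code on two letters let
    s n = 0, ..., 0, 1, 1 with lengths growing geometrically. Both states occur,
    but in a block starting in state b the letters different from b have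
    frequency at most 1/4, which produces two invariant measures
    ([sparse_measure]).

    Preimages that are not minimal: by [closure_orbit_agree] it is enough to
    exhibit two preimages x, x' of one Toeplitz sequence such that no translates
    of x converge to x'. For arbitrary h, x is itself a Toeplitz sequence and x'
    is any other preimage of its image y: returns of y to itself respect its
    essential periods ([essential_period_return]), which would force x' = x. For
    arbitrary Y, the code takes differences at a distance p, where p is a period
    of some letter a; then a preimage can be prescribed to be constant on the
    p-periodic occurrences of a ([difference_code_lift]), and two different
    constants are told apart by the orbit closure. *)

(** * Agreement of configurations and local sets *)

Section Agreement.
Context {kappa : nat}.
Implicit Types (x y z : config kappa) (A : set (config kappa)) (M : nat).

Definition agree M x y := forall i : int, - M%:Z <= i < M%:Z -> x i = y i.

Lemma agree_sym M x y : agree M x y -> agree M y x.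
Proof. by move=> xy i /xy. Qed.

Lemma agree_trans M x y z : agree M x y -> agree M y z -> agree M x z.
Proof. by move=> xy yz i iM; rewrite xy// yz. Qed.

Lemma agree_le M N x y : (M <= N)%N -> agree N x y -> agree M x y.
Proof. by move=> MN xy i iM; apply: xy; lia. Qed.

Lemma nbhs_coord x (i : int) : nbhs x [set y : config kappa | x i = y i].
Proof.
have xi : nbhs (proj i x : discrete_topology 'I_kappa) [set proj i x].
  by rewrite nbhs_principalE; apply/principal_filterP.
have := @proj_continuous int (fun=> discrete_topology 'I_kappa) i x.
move=> /(_ _ xi) nx.
have := @filterS _ (nbhs x) _ (proj i @^-1` [set proj i x]) [set y : config kappa | x i = y i].
apply; last exact: nx.
by move=> y /= /esym.
Qed.

(** All topology below is phrased through [agree]: the windows around 0 form a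
    basis of neighbourhoods. *)
Lemma nbhs_agree x A : nbhs x A <-> exists M, [set y | agree M x y] `<=` A.
Proof.
split=> [|[M]]; last first.
  have := nbhs_coord x; move: (nbhs_filter x).
  move: (nbhs x : set_system (config kappa)) => F FF coordF MA.
  suff: F [set y | agree M x y] by exact: filterS.
  elim: M {MA} => [|M IHM]; first by apply: filterS filterT => y _ i; lia.
  have FI := @filterI (config kappa) F FF.
  have := FI _ _ IHM (FI _ _ (coordF M%:Z) (coordF (- M.+1%:Z))).
  apply: filterS => y [/= xy [yp yn]] i iM.
  have [->//|iNM] := eqVneq i M%:Z; have [->//|iNS] := eqVneq i (- M.+1%:Z).
  by apply: xy; lia.
pose F := filter_from setT (fun M => [set y | agree M x y]).
suff Fx : F --> x by move=> /Fx [M _ MA]; exists M.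
have FF : Filter F.
  apply: filter_from_filter; first by exists 0%N.
  move=> M N _ _; exists (maxn M N) => // y xy; split; apply: agree_le xy; lia.
apply/cvg_sup => i U [V] [[W] oW <-] Wxi WU.
exists `|i|.+1%N => // y xy; apply: WU => /=.
by rewrite -(xy i)//; lia.
Qed.

End Agreement.

Section LocalSets.
Context {kappa : nat}.
Implicit Types (x y z : config kappa) (A B C : set (config kappa)).

(** The clopen sets of the full shift: membership is decided by finitely many
    coordinates. *)
Definition local C := exists M, forall x y, agree M x y -> C x -> C y.

Lemma local_common A B : local A -> local B -> exists M, forall x y,
  agree M x y -> (A x -> A y) /\ (B x -> B y).
Proof.
move=> [M MA] [N NB]; exists (maxn M N) => x y xy.
by split; [apply: MA|apply: NB]; apply: agree_le xy; lia.
Qed.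

Lemma local0 : local set0. Proof. by exists 0%N. Qed.

Lemma localT : local setT. Proof. by exists 0%N. Qed.

Lemma localC A : local A -> local (~` A).
Proof. by move=> [M MA]; exists M => x y xy nAx /(MA _ _ (agree_sym xy)). Qed.

Lemma localU A B : local A -> local B -> local (A `|` B).
Proof.
move=> lA lB; have [M MAB] := local_common lA lB; exists M => x y xy [] h.
  by left; apply: (MAB x y xy).1.
by right; apply: (MAB x y xy).2.
Qed.

Lemma localI A B : local A -> local B -> local (A `&` B).
Proof.
move=> lA lB; have [M MAB] := local_common lA lB; exists M => x y xy [a b].
by split; [apply: (MAB x y xy).1|apply: (MAB x y xy).2].
Qed.

Lemma local_shift (m : int) A : local A -> local (shift_iter m @^-1` A).
Proof.
move=> [M MA]; exists (M + `|m|)%N => x y xy; apply: MA => i iM.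
by apply: xy; lia.
Qed.

Lemma local_open A : local A -> open A.
Proof.
move=> [M MA]; rewrite openE => x Ax; apply/nbhs_agree; exists M => y xy.
exact: MA xy Ax.
Qed.

End LocalSets.

Lemma ultrafilter_pigeonhole (G : set_system nat) (T : finType) (f : nat -> T) :
  UltraFilter G -> exists a, G [set n | f n = a].
Proof.
move=> UG; apply: contrapT => noa.
have Gn a : \forall n \near G, f n != a.
  have [Ga|] := in_ultra_setVsetC [set n | f n = a] UG.
    by case: noa; exists a.
  by apply: filterS => n /eqP.
have /filter_ex[n /(_ (f n))] : \forall n \near G, forall a, f n != a.
  exact: filter_forall.
by rewrite eqxx.
Qed.

(** Compactness of the full shift, in the form needed for premeasures: points x n
    escaping the first n sets have a limit point, read off coordinatewise along a
    nonprincipal ultrafilter, and it would escape all of them. *)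
Lemma local_bigcup_finite (kappa : nat) (F : (set (config kappa))^nat) :
    (forall i, local (F i)) -> local (\bigcup_i F i) ->
  exists N, \bigcup_i F i `<=` \bigcup_(i < N) F i.
Proof.
move=> lF lU; apply: contrapT => noN.
have /choice[x xP] : forall N, exists x, (\bigcup_i F i) x /\
    ~ (\bigcup_(i < N) F i) x.
  move=> N; apply: contrapT => nox; apply: noN; exists N => x Ux.
  by apply: contrapT => nx; apply: nox; exists x.
have [G [UG ooG]] := ultraFilterLemma (@eventually_filter).
have /choice[z zP] : forall i : int, exists a, G [set n | x n i = a].
  by move=> i; apply: ultrafilter_pigeonhole.
have agG M : G [set n | agree M (z : config kappa) (x n)].
  elim: M => [|M IHM]; first by apply: filterS filterT => n _ i; lia.
  apply: filterS (filterI IHM (filterI (zP M%:Z) (zP (- M.+1%:Z)))).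
  move=> n [/= zn [znp znn]] i iM.
  have [->//|iNM] := eqVneq i M%:Z; have [->//|iNS] := eqVneq i (- M.+1%:Z).
  by apply: zn; lia.
have [i _ Fiz] : (\bigcup_i F i) z.
  case: lU => M MU; have [n zn] := filter_ex (agG M).
  by apply: MU (xP n).1; apply: agree_sym.
case: (lF i) => M MFi.
have Gi : G [set n | (i < n)%N] by apply: ooG; exists i.+1.
have [n [zn ni]] := filter_ex (filterI (agG M) Gi).
by apply: (xP n).2; exists i => //; apply: MFi Fiz.
Qed.

Section BorelAlgebra.
Context {k : nat}.
Notation X := (config k.+1).

(* w is meant to be read from - M to M - 1; the values elsewhere are arbitrary *)
Definition config_of_word (M : nat) (w : seq 'I_k.+1) : X :=
  fun i => nth ord0 w `|(i + M%:Z)%R|%N.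

Lemma agree_config_of_word M (x : X) : exists w, agree M x (config_of_word M w).
Proof.
exists (mkseq (fun j => x (j%:Z - M%:Z)) (M + M)) => i iM.
by rewrite /config_of_word nth_mkseq; [congr x|]; lia.
Qed.

(** The countable family of all local balls is indexed by pairs of a radius and
    a finite word. *)
Lemma open_bigcup_local (A : set X) : open A ->
  exists2 F : (set X)^nat, (forall i, local (F i)) & A = \bigcup_i F i.
Proof.
move=> oA.
pose ball (Mw : nat * seq 'I_k.+1) :=
  [set y | agree Mw.1 (config_of_word Mw.1 Mw.2) y].
pose F n := if @unpickle (nat * seq 'I_k.+1)%type n is Some Mw then
  if `[< ball Mw `<=` A >] then ball Mw else set0 else set0.
exists F => [n|].
  rewrite /F; case: unpickle => [Mw|]; last exact: local0.
  case: ifP => _; last exact: local0.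
  by exists Mw.1 => x y xy /= wx; exact: agree_trans xy.
apply/seteqP; split=> [x Ax|x [n _]]; last first.
  rewrite /F; case: unpickle => [Mw|//].
  by case: asboolP => // sA /sA.
have /nbhs_agree[M MA] : nbhs x A by move: oA; rewrite openE; apply.
have [w xw] := agree_config_of_word M x.
exists (pickle (M, w)) => //; rewrite /F pickleK.
case: asboolP => [_|[]]; first exact: agree_sym.
by move=> y wy; apply: MA; apply: agree_trans wy.
Qed.

Lemma local_measurable (A : set (borel_config k)) : local A -> measurable A.
Proof. by move=> /local_open; exact: sub_sigma_algebra. Qed.

Lemma borel_local : @measurable _ (borel_config k) = <<s @local k.+1 >>.
Proof.
apply/seteqP; split; last first.
  apply: smallest_sub; first exact: sigma_algebra_measurable.
  exact: local_measurable.
apply: smallest_sub; first exact: smallest_sigma_algebra.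
move=> _ /open_bigcup_local[F lF ->].
apply: (@bigcupT_measurable _ (g_sigma_algebraType (@local k.+1))) => i.
exact: sub_sigma_algebra.
Qed.

End BorelAlgebra.

(** * Measures on the full shift from additive functions on local sets *)

(** A copy of the full shift carrying the algebra of local sets, on which
    premeasures live, next to the Borel sigma-algebra. *)
Definition local_algebra (k : nat) : Type := config k.+1.

HB.instance Definition _ (k : nat) := Pointed.on (local_algebra k).

HB.instance Definition _ (k : nat) :=
  isAlgebraOfSets.Build default_measure_display (local_algebra k)
    (@local0 k.+1) (@localU k.+1) (@localC k.+1).

Lemma probability_local_unique (R : realType) (k : nat)
    (mu nu : probability (borel_config k) R) :
    (forall C, local C -> mu C = nu C) ->
  forall A : set (borel_config k), measurable A -> mu A = nu A.
Proof.
move=> munu A mA.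
apply: (@measure_unique _ R (borel_config k) (@local k.+1) (fun=> setT)) => //.
- exact: borel_local.
- exact: localI.
- by move=> _; exact: localT.
- by rewrite bigcup_const.
- by move=> _ /=; rewrite (@probability_setT _ (borel_config k) R mu) ltry.
Qed.

Section Extension.
Context {R : realType} {k : nat} (m : set (local_algebra k) -> R).
Hypothesis m_ge0 : forall C, local C -> 0 <= m C.
Hypothesis mT : m setT = 1.
Hypothesis mU : forall A B, local A -> local B -> A `&` B = set0 ->
  m (A `|` B) = m A + m B.

Let m0 : m set0 = 0.
Proof.
have := mU (@local0 k.+1) (@local0 k.+1) (setI0 _).
by rewrite setU0 => /eqP; rewrite -subr_eq0 opprD addrA subrr add0r oppr_eq0 => /eqP.
Qed.

(* truncated off the local sets, so as to be nonnegative on every set *)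
Definition premeasure (A : set (local_algebra k)) : \bar R :=
  if `[< local A >] then (m A)%:E else 0%E.

Let premeasureE A : local A -> premeasure A = (m A)%:E.
Proof. by move=> lA; rewrite /premeasure asboolT. Qed.

Let premeasure0 : premeasure set0 = 0%E.
Proof. by rewrite premeasureE ?m0//; exact: local0. Qed.

Let premeasure_ge0 A : (0 <= premeasure A)%E.
Proof.
rewrite /premeasure; case: ifPn => // /asboolP lA.
by rewrite lee_fin m_ge0.
Qed.

Let local_bigsetU (F : (set (local_algebra k))^nat) n :
  (forall i, local (F i)) -> local (\big[setU/set0]_(i < n) F i).
Proof.
by move=> lF; elim/big_ind: _ => //; [exact: local0|exact: localU].
Qed.

Let m_bigsetU (F : (set (local_algebra k))^nat) n :
    (forall i, local (F i)) -> trivIset setT F ->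
  m (\big[setU/set0]_(i < n) F i) = \sum_(i < n) m (F i).
Proof.
move=> lF tF; elim: n => [|n IHn]; first by rewrite !big_ord0.
rewrite !big_ord_recr/= mU ?IHn//; first exact: local_bigsetU.
apply/seteqP; split=> // x [].
rewrite -(bigcup_mkord n F) => -[i /= ni Fix] Fnx.
have in_ : i = n by apply: tF => //; exists x.
by rewrite in_ ltnn in ni.
Qed.

Let premeasure_sigma_additive : semi_sigma_additive premeasure.
Proof.
move=> F mF tF lU; have lF i : local (F i) := mF i.
have [N UN] := local_bigcup_finite lF lU.
apply: cvg_near_cst; exists N => // n /= Nn.
rewrite big_mkord (premeasureE lU).
rewrite (eq_bigr (fun i : 'I_n => (m (F i))%:E)); last first.
  by move=> i _; rewrite premeasureE.
rewrite sumEFin -m_bigsetU//; congr (m _)%:E.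
rewrite -(bigcup_mkord n F); apply/seteqP; split=> x.
  by move=> [i _ Fi]; exists i.
by move=> /UN[i /= iN Fi]; exists i => //=; exact: leq_trans Nn.
Qed.

HB.instance Definition _ := isMeasure.Build _ (local_algebra k) R premeasure
  premeasure0 premeasure_ge0 premeasure_sigma_additive.

Let ext : {measure set (g_sigma_algebraType (@measurable _ (local_algebra k)))
  -> \bar R} := measure_extension premeasure.

Definition local_extension (A : set (borel_config k)) : \bar R := ext A.

Let local_extension_sigma_additive : semi_sigma_additive local_extension.
Proof.
move=> F mF tF mU'.
by apply: (@measure_semi_sigma_additive _ _ _ ext) => [i||];
  rewrite ?/measurable/= -?borel_local.
Qed.

HB.instance Definition _ := isMeasure.Build _ (borel_config k) R local_extension
  (measure0 ext) (measure_ge0 ext) local_extension_sigma_additive.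

Let local_extensionE C : local C -> local_extension C = (m C)%:E.
Proof.
move=> lC; rewrite /local_extension /ext /= /measure_extension.
by rewrite measurable_mu_extE//= premeasureE.
Qed.

Let local_extensionT : local_extension setT = 1%E.
Proof. by rewrite local_extensionE ?mT//; exact: localT. Qed.

HB.instance Definition _ := Measure_isProbability.Build _ _ _ local_extension local_extensionT.

(** Countable additivity of the premeasure is automatic: by compactness a local
    set that is a countable disjoint union of local sets is a finite one. *)
Lemma extend_local : exists mu : probability (borel_config k) R,
  forall C, local C -> mu C = (m C)%:E.
Proof. by exists local_extension; exact: local_extensionE. Qed.

End Extension.

(** * Visit counts and the existence of invariant measures *)

Lemma ultrafilter_bounded_cvg (R : realType) (G : set_system nat)
    (f : nat -> R) (a b : R) :
  UltraFilter G -> (forall n, a <= f n <= b) -> exists l : R, f @ G --> l.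
Proof.
move=> UG fab.
have GI : (f @ G) `[a, b]%classic.
  by apply: (@filterS _ G _ setT) filterT => n _ /=; rewrite in_itv/= fab.
have [l [_ cl]] := segment_compact _ GI; exists l => V nV.
have [//|nG] := in_ultra_setVsetC (f @^-1` V) UG.
by have [y []] : ~` V `&` V !=set0 by exact: cl.
Qed.

Section Shift.
Context {kappa : nat}.
Implicit Types (x : config kappa) (C : set (config kappa)).

Lemma shift_iterD (a b : int) x :
  shift_iter a (shift_iter b x) = shift_iter (a + b) x.
Proof. by apply/funext => i; rewrite /shift_iter addrA. Qed.

Lemma shift_iter0 x : shift_iter 0 x = x.
Proof. by apply/funext => i; rewrite /shift_iter addr0. Qed.

Definition visits C x (N : nat) : nat :=
  \sum_(t < N) `[< C (shift_iter t%:Z x) >].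

Lemma visits_le C x N : (visits C x N <= N)%N.
Proof.
rewrite -[leqRHS]card_ord -sum1_card; apply: leq_sum => i _.
by case: `[< _ >].
Qed.

Lemma visits_shift C x N :
  visits (@Defs.shift kappa @^-1` C) x N = visits C (Defs.shift x) N.
Proof.
apply: eq_bigr => t _; rewrite /preimage/= /Defs.shift !shift_iterD.
by rewrite [1 + _]addrC.
Qed.

Lemma visits_cat C x M N :
  visits C x (M + N) = (visits C x M + visits C (shift_iter M%:Z x) N)%N.
Proof.
rewrite /visits big_split_ord/=; congr (_ + _)%N; apply: eq_bigr => t _.
by rewrite shift_iterD PoszD [t%:Z + _]addrC.
Qed.

Lemma visits_shift_le C x N :
  (visits C (Defs.shift x) N <= (visits C x N).+1)%N /\
  (visits C x N <= (visits C (Defs.shift x) N).+1)%N.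
Proof.
have := visits_cat C x 1 N; rewrite addnC visits_cat.
have := visits_le C x 1; have := visits_le C (shift_iter N x) 1.
rewrite -/(Defs.shift x); lia.
Qed.

Lemma visitsT x N : visits setT x N = N.
Proof.
rewrite -[RHS]card_ord -sum1_card; apply: eq_bigr => i _.
by rewrite asboolT.
Qed.

Lemma visitsU A B x N : A `&` B = set0 ->
  visits (A `|` B) x N = (visits A x N + visits B x N)%N.
Proof.
move=> AB; rewrite /visits -big_split; apply: eq_bigr => t _ /=.
rewrite asbool_or; case: asboolP => [a|na]; last by rewrite add0n.
case: asboolP => // b.
have : (A `&` B) (shift_iter t x) by split.
by rewrite AB.
Qed.

End Shift.

Definition borel_shift (k : nat) : borel_config k -> borel_config k :=
  @Defs.shift k.+1.

Lemma borel_shift_measurable (k : nat) : measurable_fun setT (@borel_shift k).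
Proof.
apply: (@measurability _ _ (borel_config k) (borel_config k)).
  exact: borel_local.
move=> _ [C lC <-]; rewrite setTI; apply: local_measurable.
exact: local_shift.
Qed.

HB.instance Definition _ (k : nat) := isMeasurableFun.Build _ _
  (borel_config k) (borel_config k) (@borel_shift k) (@borel_shift_measurable k).

Lemma invariant_local (R : realType) (k : nat)
    (mu : probability (borel_config k) R) :
    (forall C, local C -> mu (@Defs.shift k.+1 @^-1` C) = mu C) ->
  forall A : set (borel_config k), measurable A ->
    mu (@Defs.shift k.+1 @^-1` A) = mu A.
Proof.
move=> muC A mA.
exact: (@probability_local_unique R k (distribution mu (@borel_shift k)) mu).
Qed.

(** The visit frequencies along longer and longer orbit segments converge along
    an ultrafilter; the limit is additive on local sets, and invariant since
    shifting a segment changes a visit count by at most 1. *)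
Lemma krylov_bogoliubov (R : realType) (k : nat) (X : set (config k.+1))
    (x : nat -> config k.+1) (N : nat -> nat) :
    closed X -> (forall i (t : nat), X (shift_iter t%:Z (x i))) ->
    (forall i, (i < N i)%N) ->
  exists mu : probability (borel_config k) R, invariant_probability X mu /\
    forall C (c : R), local C ->
      (forall i, (visits C (x i) (N i))%:R / (N i)%:R <= c) -> (mu C <= c%:E)%E.
Proof.
move=> cX Xx iN.
have [G [UG ooG]] := ultraFilterLemma (@eventually_filter).
pose freq C i : R := (visits C (x i) (N i))%:R / (N i)%:R.
have N0 i : 0 < (N i)%:R :> R by rewrite ltr0n (leq_ltn_trans _ (iN i)).
have freq_ge0 C i : 0 <= freq C i by rewrite divr_ge0.
have freq_le1 C i : freq C i <= 1.
  by rewrite ler_pdivrMr// mul1r ler_nat visits_le.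
have /choice[m mP] : forall C, exists l : R, freq C @ G --> l.
  move=> C; apply: (ultrafilter_bounded_cvg (a := 0) (b := 1) UG) => n.
  by rewrite freq_ge0 freq_le1.
have m_uniq C l : freq C @ G --> l -> m C = l.
  by move=> h; apply: (cvg_unique _ (mP C) h); exact: norm_hausdorff.
have m_le C c : (forall i, freq C i <= c) -> m C <= c.
  by move=> h; apply: (cvgr_to_le (mP C)); apply: nearW.
have m_ge0 C : local C -> 0 <= m C.
  by move=> _; apply: (cvgr_to_ge (mP C)); apply: nearW.
have mT : m setT = 1.
  apply: m_uniq; rewrite (_ : freq setT = cst 1); first exact: cvg_cst.
  by apply/funext => i; rewrite /freq visitsT divff// gt_eqF.
have mU A B : local A -> local B -> A `&` B = set0 -> m (A `|` B) = m A + m B.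
  move=> _ _ AB; apply: m_uniq; rewrite (_ : freq _ = freq A \+ freq B).
    exact: cvgD (mP A) (mP B).
  by apply/funext => i; rewrite /freq/= visitsU// natrD mulrDl.
have [mu muE] := extend_local m_ge0 mT mU.
exists mu; split; last by move=> C c lC h; rewrite muE// lee_fin m_le.
split.
  have oX : open (~` X) by rewrite openC.
  have mX : @measurable _ (borel_config k) X.
    by rewrite -[X]setCK; apply: measurableC; exact: sub_sigma_algebra.
  apply/eqP; rewrite eq_le probability_le1//=.
  have mnX : @measurable _ (borel_config k) (~` X) by exact: sub_sigma_algebra.
  suff h : mu (~` X) = 0%E by rewrite -[X]setCK probability_setC// h sube0.
  have [F lF nXF] := open_bigcup_local oX; rewrite nXF.
  have mF i : @measurable _ (borel_config k) (F i) := local_measurable (lF i).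
  apply/(@negligibleP _ (borel_config k)); first exact: bigcupT_measurable.
  apply: negligible_bigcup => i; apply/negligibleP => //.
  apply: (etrans (muE _ (lF i))); congr EFin; apply/m_uniq.
  rewrite (_ : freq _ = cst 0); first exact: cvg_cst.
  apply/funext => j; rewrite /freq /visits big1 ?mul0r// => t _.
  rewrite asboolF// => Ft; have : (~` X) (shift_iter t (x j)).
    by rewrite nXF; exists i.
  by apply.
apply: invariant_local => C lC.
rewrite !muE//; last exact: (local_shift 1).
congr EFin; apply: m_uniq.
rewrite (_ : freq _ = (freq (@Defs.shift k.+1 @^-1` C) \- freq C) \+ freq C); last first.
  by apply/funext => i /=; rewrite subrK.
rewrite -[m C]add0r; apply: cvgD (mP C).
have inv0 : (fun n : nat => n.+1%:R^-1 : R) @ G --> (0 : R).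
  apply: cvg_trans (@cvg_harmonic R); exact: cvg_app.
have invN0 : (fun n : nat => - n.+1%:R^-1 : R) @ G --> (0 : R).
  by rewrite -oppr0; exact: cvgN.
apply: (squeeze_cvgr _ invN0 inv0); apply: nearW => n /=.
rewrite -mulrBl; have [v1 v2] := visits_shift_le C (x n) (N n).
rewrite visits_shift.
have le1 : `|(visits C (Defs.shift (x n)) (N n))%:R - (visits C (x n) (N n))%:R : R| <= 1.
  by rewrite -(ler_nat R) -natr1 in v1; rewrite -(ler_nat R) -natr1 in v2;
    rewrite ler_norml; lra.
rewrite -ler_norml normrM (@ger0_norm _ _^-1) ?invr_ge0// -[leRHS]mul1r.
apply: ler_pM; rewrite ?invr_ge0//.
by rewrite lef_pV2 ?posrE ?N0 ?ltr0Sn ?ler_nat.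
Qed.

(** * Subshifts, periods and regularity *)

Section Subshifts.
Context {kappa : nat}.
Implicit Types (x y z xi : config kappa) (X Y : set (config kappa)).

Lemma closure_agree X x :
  closure X x <-> forall M, exists2 y, X y & agree M x y.
Proof.
split=> [cl M|cl B /nbhs_agree[M MB]].
  have [|y [Xy xy]] := cl [set y | agree M x y]; last by exists y.
  by apply/nbhs_agree; exists M.
by have [y Xy xy] := cl M; exists y; split => //; exact: MB.
Qed.

Lemma closure_orbit_agree x z :
  closure (Defs.orbit x) z <-> forall M, exists n, agree M z (shift_iter n x).
Proof.
split=> [/closure_agree cl M|cl]; first by have [_ [n _ <-] ?] := cl M; exists n.
by apply/closure_agree => M; have [n ?] := cl M; exists (shift_iter n x) => //; exists n.
Qed.

Lemma language_subshift_closure xi : language_subshift xi = closure (Defs.orbit xi).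
Proof.
apply/seteqP; split=> x => [Lx|/closure_orbit_agree cl m _ [n <-]].
  apply/closure_orbit_agree => M.
  have [n /eqP] := Lx _ _ (ex_intro _ (- M%:Z) (erefl (window x (- M%:Z) (M + M)))).
  rewrite eqEtuple => /forallP nP; exists (n + M%:Z) => i iM.
  have iM' : (`|(i + M%:Z)%R| < M + M)%N by lia.
  have := nP (Ordinal iM'); rewrite !tnth_mktuple /= => /eqP.
  rewrite /shift_iter (_ : - M%:Z + _ = i); last by lia.
  by move=> <-; congr xi; lia.
have [j xj] := cl (`|n| + m)%N; exists (n + j).
apply: eq_from_tnth => i; rewrite !tnth_mktuple xj ?/shift_iter; last first.
  by have := ltn_ord i; lia.
by congr xi; lia.
Qed.

Lemma closed_language_subshift xi : closed (language_subshift xi).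
Proof. by rewrite language_subshift_closure; exact: closed_closure. Qed.

Lemma language_subshiftP xi x :
  language_subshift xi x <-> forall M, exists n, agree M x (shift_iter n xi).
Proof. by rewrite language_subshift_closure; exact: closure_orbit_agree. Qed.

Lemma language_subshift_refl xi : language_subshift xi xi.
Proof. by []. Qed.

Lemma agree_shift_iter M (n : int) x y :
  agree (M + `|n|) x y -> agree M (shift_iter n x) (shift_iter n y).
Proof. by move=> xy i iM; apply: xy; lia. Qed.

Lemma language_subshift_shift xi x (n : int) :
  language_subshift xi x -> language_subshift xi (shift_iter n x).
Proof.
move=> /language_subshiftP Lx; apply/language_subshiftP => M.
have [j xj] := Lx (M + `|n|)%N; exists (n + j).
by rewrite -shift_iterD; exact: agree_shift_iter.
Qed.

(** Pigeonhole: if no residue class served all M, then some M large enough would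
    defeat all p classes. *)
Lemma return_class x z (p : nat) : (0 < p)%N ->
    (forall M, exists n, agree M z (shift_iter n x)) ->
  exists c : nat, forall M, exists j : int,
    agree M z (shift_iter (c%:Z + p%:Z * j) x).
Proof.
move=> p0 ret; apply: contrapT => noc.
have /choice[f fP] : forall c : nat, exists M, forall j : int,
    ~ agree M z (shift_iter (c%:Z + p%:Z * j) x).
  move=> c; apply: contrapT => nc; apply: noc; exists c => M.
  apply: contrapT => nj; apply: nc; exists M => j aj.
  by apply: nj; exists j.
have [n nz] := ret (\max_(c < p) f c).
have np : (`|(n %% p%:Z)%Z| < p)%N by lia.
apply: (fP `|(n %% p%:Z)%Z|%N (n %/ p%:Z)%Z).
apply: (agree_le (@leq_bigmax _ (fun c : 'I_p => f c) (Ordinal np))).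
rewrite (_ : _ + _ = n)//=; have := divz_eq n p%:Z; lia.
Qed.

Section BlockCode.
Context {ell : nat} (h : block_code kappa ell).

Lemma agree_sliding M x y : agree (M + ell) x y ->
  agree M (sliding_block_code h x) (sliding_block_code h y).
Proof.
move=> xy i iM; congr h; apply: eq_from_tnth => j; rewrite !tnth_mktuple.
by apply: xy; have := ltn_ord j; lia.
Qed.

Lemma sliding_shift (n : int) x : sliding_block_code h (shift_iter n x) =
  shift_iter n (sliding_block_code h x).
Proof.
apply/funext => i; congr h; apply: eq_from_tnth => j; rewrite !tnth_mktuple.
by rewrite /shift_iter; congr x; lia.
Qed.

Lemma closed_sliding_preimage Y :
  closed Y -> closed (sliding_block_code h @^-1` Y).
Proof.
move=> cY x /closure_agree cx; apply: cY; apply/closure_agree => M.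
have [y Yy xy] := cx (M + ell)%N; exists (sliding_block_code h y) => //.
exact: agree_sliding.
Qed.

End BlockCode.
End Subshifts.

Section Periods.
Context {kappa : nat}.
Implicit Types (xi y : config kappa).

Lemma PerP xi p m : Per xi p m <-> forall k : int, xi (m + k * p%:Z) = xi m.
Proof.
split=> [[a _ am] k|xim]; last by exists (xi m).
by rewrite am -(am 0) mul0r addr0.
Qed.

(** If the positions that are not p-periodic lie in a short run modulo p, no
    q < p can do as well as p: the translates of any residue class by multiples
    of gcd(q, p) leave the run, so q would be a period of xi. *)
Lemma essential_period_run xi (p w : nat) (c : int) :
    ~ Defs.periodic xi -> (0 < w)%N -> (2 * w <= p)%N ->
    (forall m, w%:Z <= ((m - c) %% p%:Z)%Z -> Per xi p m) ->
  essential_period xi p.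
Proof.
move=> nper w0 wp run; split; first by lia.
  exists (c + w%:Z); apply: run; rewrite addrAC subrr add0r.
  by rewrite modz_small//; lia.
case=> q qp sub; apply: nper; exists q; first by lia.
have escape m : exists j : int, Per xi p (m + q%:Z * j).
  pose r := ((m - c) %% p%:Z)%Z.
  have [wr|rw] := leP w%:Z r; first by exists 0; rewrite mulr0 addr0; exact: run.
  have [u [v uv]] := Bezoutz q%:Z p%:Z.
  pose g := gcdn q p; have guv : u * q%:Z + v * p%:Z = g%:Z by rewrite uv.
  have /dvdnP[e pe] : (g %| p)%N by exact: dvdn_gcdr.
  have gq : (g <= q)%N by apply: dvdn_leq; [lia|exact: dvdn_gcdl].
  have e2 : (2 <= e)%N by case: e pe => [|[|e]] //; lia.
  have g2 : (2 * g <= p)%N by rewrite pe leq_mul2r e2 orbT.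
  pose t := ((p - 1 - `|r|) %/ g)%N.
  have g0 : (0 < g)%N by rewrite gcdn_gt0; lia.
  have t1 := leq_divM (p - 1 - `|r|) g.
  have t2 := ltn_ceil (p - 1 - `|r|) g0.
  rewrite -/t in t1 t2; rewrite mulSn in t2.
  (* r + t * g is the largest number below p congruent to r modulo g, hence it
     is at least p - g >= p / 2 >= w *)
  exists (t%:Z * u); apply: run.
  have r0 : 0 <= r by rewrite modz_ge0//; lia.
  have -> : m + q%:Z * (t%:Z * u) - c =
     (((m - c) %/ p%:Z)%Z - t%:Z * v) * p%:Z + (r + t%:Z * g%:Z).
    have := divz_eq (m - c) p%:Z; rewrite -guv -/r addrAC.
    by move: ((m - c) %/ p%:Z)%Z => d ->; ring.
  rewrite modzMDl modz_small; first by clear -r0 rw t1 t2 g2 wp; clearbody r t g; lia.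
  by clear -r0 rw t1 t2 g2 wp w0; clearbody r t g; lia.
move=> m; have [j [a _ aj]] := escape m.
have aq := sub a _ aj.
have := aq (- j); have := aq (1 - j).
rewrite (_ : _ + _ * _ = m + q%:Z); last by lia.
by rewrite (_ : m + q%:Z * j + - j * q%:Z = m) => [-> ->|]; last by lia.
Qed.

(** Returns of xi near itself only happen along multiples of an essential period:
    returning along the class c makes every p-periodic position c-periodic. *)
Lemma essential_period_return xi (p c : nat) : essential_period xi p ->
    (forall M, exists j : int, agree M xi (shift_iter (c%:Z + p%:Z * j) xi)) ->
  (p %| c)%N.
Proof.
move=> [p0 _ noq] ret; apply: contrapT => pc; apply: noq.
exists (c %% p)%N => [|a m am].
  by rewrite ltn_mod p0 andbT lt0n; apply/negP; exact: pc.
(* at a return time, xi has at m' - c its value at a position congruent to m' *)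
have step m' : Per_letter xi p a m' -> Per_letter xi p a (m' - c%:Z).
  move=> am' k; have [j ->] := ret `|(m' - c%:Z + k * p%:Z)|.+1; last by lia.
  by rewrite -(am' (k + j)) /shift_iter; congr xi; lia.
have steps i : Per_letter xi p a (m - i%:Z * c%:Z).
  elim: i => [|i IHi]; first by rewrite mul0r subr0.
  by have := step _ IHi; rewrite (_ : _ - _ = m - i.+1%:Z * c%:Z)//; lia.
move=> k; have [Q [i kE]] : exists (Q : int) (i : nat), k = - (Q * p%:Z + i%:Z).
  exists ((- k) %/ p%:Z)%Z, `|((- k) %% p%:Z)%Z|%N.
  rewrite gez0_abs ?modz_ge0//; last by lia.
  by rewrite -divz_eq opprK.
rewrite -(steps i (- (Q * c%:Z) - k * (c %/ p)%N%:Z)); congr xi.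
have := divn_eq c p; move: (c %/ p)%N (c %% p)%N => s t ->.
by rewrite kE PoszD PoszM; ring.
Qed.

(** The criterion by which all Toeplitz sequences below are shown to be regular:
    at most w residues modulo p k escape Per xi (p k), a fraction that tends
    to 0. *)
Lemma toeplitz_regular_run (R : realType) xi (p : nat -> nat) (c : nat -> int)
    (w : nat) :
    ~ Defs.periodic xi -> (0 < w)%N -> (forall k, (p k < p k.+1)%N) ->
    (forall k, (p k %| p k.+1)%N) -> (forall k, (2 * w <= p k)%N) ->
    (forall k m, w%:Z <= ((m - c k) %% (p k)%:Z)%Z -> Per xi (p k) m) ->
    (forall m, exists k, w%:Z <= ((m - c k) %% (p k)%:Z)%Z) ->
  toeplitz xi /\ regular R xi.
Proof.
move=> nper w0 pS pD wp run cover; split.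
  split=> // n; have [k /run/PerP nk] := cover n; exists (p k).
    by have := wp k; lia.
  by move=> j; rewrite mulrC nk.
exists p; first split => //.
- move=> k; apply: (essential_period_run nper w0 (wp k)) (run k).
- by apply/seteqP; split => // m _; have [k /run mk] := cover m; exists k.
have pk k : (k < p k)%N by elim: k => [|k IHk]; [have := wp 0%N|have := pS k]; lia.
pose d k := #|[pred i : 'I_(p k) | (i : nat)%:Z \in Per xi (p k)]|.
have d1 k : (d k <= p k)%N by rewrite -[leqRHS]card_ord max_card.
have dw k : (p k <= d k + w)%N.
  rewrite -[leqLHS]card_ord -(cardC [pred i : 'I_(p k) | (i : nat)%:Z \in Per xi (p k)]).
  rewrite leq_add2l; case: w w0 wp run {cover} => // w _ wp run.
  pose f (i : 'I_(p k)) : 'I_w.+1 := inord `|((i%:Z - c k) %% (p k)%:Z)%Z|%N.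
  rewrite -[leqRHS]card_ord -(@card_in_image _ _ f) ?max_card// => i j.
  have small (i' : 'I_(p k)) : i' \in [predC [pred i : 'I_(p k) |
      (i : nat)%:Z \in Per xi (p k)]] -> ((i'%:Z - c k) %% (p k)%:Z)%Z < w.+1%:Z.
    by rewrite !inE => /negP nP; rewrite ltNge; apply/negP => /run h; apply: nP; rewrite inE.
  move=> /small si /small sj /(congr1 (@nat_of_ord _)).
  have pk0 : (p k)%:Z != 0 by have := wp k; lia.
  have := modz_ge0 (i%:Z - c k) pk0; have := modz_ge0 (j%:Z - c k) pk0.
  rewrite !inordK; [|lia|lia] => gi gj eqij.
  apply/val_inj/eqP => /=; have ip := ltn_ord i; have jp := ltn_ord j.
  have /eqP : ((i%:Z - c k) %% (p k)%:Z)%Z = ((j%:Z - c k) %% (p k)%:Z)%Z by lia.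
  by rewrite eqz_modDr !modz_small; lia.
have lim1 : (fun k => 1 - w%:R * k.+1%:R^-1 : R) @ \oo --> (1 : R).
  rewrite -[X in _ --> X]subr0 -(mulr0 w%:R); apply: cvgB; first exact: cvg_cst.
  by apply: cvgMr; exact: cvg_harmonic.
have lim2 : (fun=> 1 : R) @ \oo --> (1 : R) by exact: cvg_cst.
apply: (squeeze_cvgr _ lim1 lim2); apply: nearW => k.
have p0 : 0 < (p k)%:R :> R by rewrite ltr0n; have := pk k; lia.
rewrite -/(d k) ler_pdivlMr// ler_pdivrMr// mul1r ler_nat d1 andbT.
rewrite mulrBl mul1r lerBlDr.
apply: (@le_trans _ _ ((d k)%:R + w%:R)); first by rewrite -natrD ler_nat.
rewrite lerD2l -mulrA ler_peMr// mulrC ler_pdivlMr// mul1r ler_nat.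
exact: pk.
Qed.

End Periods.

(** * Toeplitz sequences with one hole per period *)

Section HoleFilling.
Context {k : nat} (s : nat -> seq 'I_k.+1).
Implicit Types (xi : config k.+1) (m j : int) (n i : nat).

(** At level n the positions outside a single residue class, the holes
    hole_class n j, have been filled periodically. The holes of index 1 modulo
    (size (s n)).+1 stay open for level n.+1, the others receive the letters of
    s n in order, beginning at index 2. Keeping the holes of index 0 open would
    leave position 0 open for ever; with index 1 the holes move off to infinity
    in both directions. *)
Fixpoint level_period n : nat :=
  if n is n'.+1 then level_period n' * (size (s n')).+1 else 1.

Fixpoint level_hole n : nat :=
  if n is n'.+1 then level_hole n' + level_period n' else 0.

Definition hole_class n j : int := (level_hole n)%:Z + (level_period n)%:Z * j.

Definition fills_holes xi := forall n j i, (i < size (s n))%N ->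
  xi (hole_class n ((size (s n)).+1%:Z * j + i.+2%:Z)) = nth ord0 (s n) i.

Lemma hole_class_succ n j :
  hole_class n.+1 j = hole_class n ((size (s n)).+1%:Z * j + 1).
Proof. by rewrite /hole_class /= PoszD PoszM; ring. Qed.

Lemma level_period_gt0 n : (0 < level_period n)%N.
Proof. by elim: n => //= n IHn; rewrite muln_gt0 IHn. Qed.

Lemma level_period_dvdS n : (level_period n %| level_period n.+1)%N.
Proof. exact: dvdn_mulr. Qed.

Lemma hole_class_inj n : injective (hole_class n).
Proof.
move=> j j' /addrI; apply: mulfI.
by have := level_period_gt0 n; lia.
Qed.

Lemma hole_class_le n n' j : (n <= n')%N -> exists j', hole_class n' j = hole_class n j'.
Proof.
elim: n' j => [|n' IHn'] j; first by rewrite leqn0 => /eqP ->; exists j.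
rewrite leq_eqVlt => /predU1P[->|]; first by exists j.
by rewrite ltnS hole_class_succ => /IHn'; apply.
Qed.

Lemma hole_class_mod n m : ((m - (level_hole n)%:Z) %% (level_period n)%:Z)%Z = 0
  -> exists j, m = hole_class n j.
Proof.
move=> m0; exists ((m - (level_hole n)%:Z) %/ (level_period n)%:Z)%Z.
have := divz_eq (m - (level_hole n)%:Z) (level_period n)%:Z.
by rewrite m0 addr0 mulrC /hole_class => <-; rewrite addrC subrK.
Qed.

(** A position is filled at the only level at which it is a hole of index other
    than 1. *)
Lemma hole_digit_uniq n n' j j' i i' :
    (i < size (s n))%N -> (i' < size (s n'))%N ->
    hole_class n ((size (s n)).+1%:Z * j + i.+2%:Z) =
    hole_class n' ((size (s n')).+1%:Z * j' + i'.+2%:Z) ->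
  nth ord0 (s n) i = nth ord0 (s n') i'.
Proof.
wlog nn' : n n' j j' i i' / (n <= n')%N.
  move=> wl is_ i's eqm; have [nn'|n'n] := leqP n n'; first exact: wl eqm.
  by apply/esym; apply: wl (esym eqm) => //; exact: ltnW.
move: nn'; rewrite leq_eqVlt => /predU1P[<-|nn'] is_ i's eqm.
  suff -> : i = i' by [].
  have := hole_class_inj eqm; move: (size (s n)) is_ i's => q is_ i's eqi.
  have [jj|jj|jj] := ltgtP j j'; last by rewrite jj in eqi; lia.
    have : q.+1%:Z * (j' - j) >= q.+1%:Z by rewrite ler_peMr//; lia.
    by rewrite mulrBr; lia.
  have : q.+1%:Z * (j - j') >= q.+1%:Z by rewrite ler_peMr//; lia.
  by rewrite mulrBr; lia.
have [j2 ej2] := hole_class_le ((size (s n')).+1%:Z * j' + i'.+2%:Z) nn'.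
move: eqm; rewrite ej2 hole_class_succ => /hole_class_inj.
move: (size (s n)) is_ => q is_ eqi.
have [jj|jj] := leP j2 j.
  have : 0 <= q.+1%:Z * (j - j2) by apply: mulr_ge0; lia.
  by rewrite mulrBr; lia.
have : q.+1%:Z * (j2 - j) >= q.+1%:Z by rewrite ler_peMr//; lia.
by rewrite mulrBr; lia.
Qed.

Lemma fills_holes_exists : exists xi, fills_holes xi.
Proof.
suff /choice[xi xiP] : forall m, exists a, forall n j i, (i < size (s n))%N ->
    m = hole_class n ((size (s n)).+1%:Z * j + i.+2%:Z) -> a = nth ord0 (s n) i.
  by exists xi => n j i is_; apply: xiP.
move=> m; have [[[[n j] i] [is_ me]]|none] := pselect (exists nji : nat * int * nat,
    (nji.2 < size (s nji.1.1))%N /\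
    m = hole_class nji.1.1 ((size (s nji.1.1)).+1%:Z * nji.1.2 + nji.2.+2%:Z)).
  exists (nth ord0 (s n) i) => n' j' i' is' me'.
  by apply: (@hole_digit_uniq n n' j j') => //; rewrite -me'.
exists ord0 => n j i is_ me; exfalso; apply: none.
by exists (n, j, i).
Qed.

Hypothesis s_ge2 : forall n, (2 <= size (s n))%N.

Lemma level_periodS n : (3 * level_period n <= level_period n.+1)%N.
Proof. by rewrite /= mulnC leq_mul2l; rewrite ltnS s_ge2 orbT. Qed.

Lemma level_hole_bounds n :
  (n <= level_hole n)%N /\ (level_hole n + n < level_period n)%N.
Proof.
elim: n => [//|n [h1 h2]]; have := level_periodS n.
by move: (level_period n.+1) => P; rewrite /=; lia.
Qed.

Lemma hole_class_escape n m : (`|m| < n)%N -> forall j, m <> hole_class n j.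
Proof.
move=> mn j mE; have [h1 h2] := level_hole_bounds n; move: mE; rewrite /hole_class.
have [j0|j0] := leP 0 j.
  have : 0 <= (level_period n)%:Z * j by apply: mulr_ge0.
  by lia.
have : (level_period n)%:Z * (- 1 - j) >= 0 by apply: mulr_ge0; lia.
by rewrite mulrBr; lia.
Qed.

Context (xi : config k.+1).
Hypothesis fill : fills_holes xi.

Lemma not_hole_Per n m : (forall j, m <> hole_class n j) -> Per xi (level_period n) m.
Proof.
elim: n m => [|n IHn] m nh.
  by exfalso; apply: (nh m); rewrite /hole_class /= mul1r add0r.
have [[t mt]|noh] := pselect (exists j, m = hole_class n j); last first.
  have /PerP mP : Per xi (level_period n) m by apply: IHn => j mj; apply: noh; exists j.
  apply/PerP => j; rewrite -[RHS](mP (j * (size (s n)).+1%:Z)).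
  by congr xi; rewrite /= PoszM; ring.
pose q := (size (s n)).+1; pose r := ((t - 1) %% q%:Z)%Z; pose j := ((t - 1) %/ q%:Z)%Z.
have tE : t - 1 = q%:Z * j + r by rewrite mulrC -divz_eq.
have r0 : 0 <= r by apply: modz_ge0.
have rq : r < q%:Z by apply: ltz_pmod.
have rn0 : r != 0.
  apply/eqP => r_0; apply: (nh j); rewrite hole_class_succ mt.
  by congr hole_class; move: tE; rewrite r_0 /q; lia.
have xi_m j' : xi (hole_class n (q%:Z * j' + `|r|.-1.+2%:Z)) = nth ord0 (s n) `|r|.-1.
  by apply: fill; lia.
have mE : m = hole_class n (q%:Z * j + `|r|.-1.+2%:Z).
  by rewrite mt; congr hole_class; lia.
apply/PerP => j'; rewrite [in RHS]mE xi_m -(xi_m (j + j')) mE; congr xi.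
by rewrite /hole_class /= PoszM -/q; ring.
Qed.

Lemma not_hole_run n m :
  1 <= ((m - (level_hole n)%:Z) %% (level_period n)%:Z)%Z ->
  Per xi (level_period n) m.
Proof.
move=> m1; apply: not_hole_Per => j mj; move: m1.
by rewrite mj /hole_class addrAC subrr add0r mulrC modzMl.
Qed.

Lemma escape_run n m : (`|m| < n)%N ->
  1 <= ((m - (level_hole n)%:Z) %% (level_period n)%:Z)%Z.
Proof.
move=> mn; rewrite -gtz0_ge1 lt0r modz_ge0 ?andbT; last first.
  by have := level_period_gt0 n; lia.
by apply/eqP => /hole_class_mod[j]; exact: hole_class_escape.
Qed.

Hypothesis s_letters : forall n, exists i i', [/\ (i < size (s n))%N,
  (i' < size (s n))%N & nth ord0 (s n) i != nth ord0 (s n) i'].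

(** A period t would carry every hole of level t to filled positions in one
    residue class, hence force all holes to carry the same letter. *)
Lemma fills_holes_not_periodic : ~ Defs.periodic xi.
Proof.
case=> t t0 xit.
have t_lt : (t < level_period t)%N by have [_] := level_hole_bounds t; lia.
have const j : xi (hole_class t j) = xi (hole_class t 0 + t%:Z).
  rewrite -xit; have /PerP/(_ j) <- : Per xi (level_period t) (hole_class t 0 + t%:Z).
    apply: not_hole_run; rewrite /hole_class mulr0 addr0 addrAC subrr add0r.
    by rewrite modz_small; lia.
  by congr xi; rewrite /hole_class; ring.
have [i [i' [is_ i's /eqP]]] := s_letters t; apply.
by rewrite -(fill 0 is_) -(fill 0 i's) !const.
Qed.

End HoleFilling.

(** * Permutative block codes as skew products *)

Lemma window_nth (k m : nat) (x : config k.+1) (i : int) (t : nat) :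
  (t < m)%N -> nth ord0 (window x i m) t = x (i + t%:Z).
Proof.
by move=> tm; rewrite -[t]/(nat_of_ord (Ordinal tm)) -tnth_nth tnth_mktuple.
Qed.

Lemma eq_window (k m : nat) (x : config k.+1) (i : int) (w : m.-tuple 'I_k.+1) :
  (forall t, (t < m)%N -> x (i + t%:Z) = nth ord0 w t) -> window x i m = w.
Proof.
by move=> xw; apply: eq_from_tnth => t; rewrite tnth_mktuple xw// -tnth_nth.
Qed.

Lemma window_rcons (k m : nat) (x : config k.+1) (i : int) :
  window x i m.+1 = [tuple of rcons (window x i m) (x (i + m%:Z))].
Proof.
have := @window_nth k m x i; move: (window x i m) => w wP.
apply: eq_window => t; rewrite /= nth_rcons size_tuple ltnS leq_eqVlt.
move=> /predU1P[->|tm]; first by rewrite ltnn eqxx.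
by rewrite tm wP.
Qed.

Section Permutative.
Context {k l : nat} (h : block_code k.+1 l.+1).
Hypothesis hP : permutative h.
Notation A := 'I_k.+1.
Notation state := (l.-tuple A).
Implicit Types (y z : config k.+1) (u v : state) (a : A) (i : int) (w : seq A).

(** For a permutative code of length l.+1, a preimage of y is driven by y: its
    window of length l (the state) is moved by the permutation step (y i). *)
Definition next_letter u a : A := invF (bij_inj (hP u).1) a.

Definition next_window u a : l.+1.-tuple A := [tuple of rcons u (next_letter u a)].

Lemma next_windowE u a : h (next_window u a) = a.
Proof. exact: (f_invF (bij_inj (hP u).1)). Qed.

Definition step a u : state := [tuple of behead (next_window u a)].

(** Permutativity on the left recovers the letter that step discards. *)
Lemma step_inj a : injective (step a).
Proof.
move=> u u' uu'.
have e : next_window u a = next_window u' a.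
  have e1 : next_window u a = [tuple of thead (next_window u a) :: step a u].
    exact: tuple_eta.
  have e2 : next_window u' a = [tuple of thead (next_window u' a) :: step a u].
    by rewrite uu'; exact: tuple_eta.
  have := next_windowE u a; rewrite -[RHS](next_windowE u' a) e1 e2.
  by move=> /(bij_inj (hP (step a u)).2) ->.
by move: (congr1 val e) => /= /rcons_inj[/val_inj].
Qed.

Definition letter_perm a : {perm state} := perm (@step_inj a).

Lemma window_step z i :
  window z (i + 1) l = step (sliding_block_code h z i) (window z i l).
Proof.
have full : next_window (window z i l) (sliding_block_code h z i) = window z i l.+1.
  rewrite [RHS]window_rcons; congr [tuple of rcons _ _].
  apply: (bij_inj (hP (window z i l)).1).
  by rewrite -/(next_window _ _) next_windowE [RHS]/= -window_rcons.
apply: eq_window => t tl; rewrite /step full /= nth_behead window_nth//.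
by congr z; lia.
Qed.

Definition run u w : state := foldl (fun u a => step a u) u w.

Lemma run_cat u w w' : run u (w ++ w') = run (run u w) w'.
Proof. exact: foldl_cat. Qed.

Lemma run_rcons u w a : run u (rcons w a) = step a (run u w).
Proof. by rewrite /run foldl_rcons. Qed.

Lemma run_perm w : exists P : {perm state}, forall u, run u w = P u.
Proof.
exists (\prod_(a <- w) letter_perm a)%g => u.
elim: w u => [|a w IHw] u; first by rewrite big_nil perm1.
by rewrite big_cons permM permE -IHw.
Qed.

Lemma run_order w : exists2 N, (0 < N)%N & forall u, iter N (run^~ w) u = u.
Proof.
have [P runP] := run_perm w; exists #[P]%g => [|u]; first exact: order_gt0.
rewrite -[RHS](perm1 u) -(expg_order P) permX.
by apply: eq_iter.
Qed.

Lemma window_run z i n : window z (i + n%:Z) l =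
  run (window z i l) [seq sliding_block_code h z (i + t%:Z) | t <- iota 0 n].
Proof.
elim: n => [|n IHn]; first by rewrite addr0.
rewrite -(addn1 n) iotaD map_cat run_cat -IHn /= add0n.
by rewrite -window_step; congr (window z _ l); lia.
Qed.

Lemma lift_determined z z' i i' n :
    (forall t, (t < n)%N ->
       sliding_block_code h z (i + t%:Z) = sliding_block_code h z' (i' + t%:Z)) ->
    window z i l = window z' i' l ->
  forall t, (t < n + l)%N -> z (i + t%:Z) = z' (i' + t%:Z).
Proof.
move=> eqy eqw.
have windows t : (t <= n)%N -> window z (i + t%:Z) l = window z' (i' + t%:Z) l.
  move=> tn; rewrite !window_run eqw; congr run; apply/eq_in_map => t'.
  by rewrite mem_iota add0n => /andP[_ t't]; apply: eqy; exact: leq_trans tn.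
move=> t tnl; have [tl|lt] := ltnP t l.
  by rewrite -!(window_nth _ _ tl) eqw.
have tn : (t - l < n)%N by lia.
have := eqy _ tn; rewrite /sliding_block_code !window_rcons windows; last by lia.
move=> /(bij_inj (hP _).1); rewrite (_ : i + _ + _ = i + t%:Z); last by lia.
by rewrite (_ : i' + _ + _ = i' + t%:Z); last by lia.
Qed.

Lemma two_sided_orbit (S : finType) (P : int -> {perm S}) (x0 : S) :
  exists V : int -> S, V 0 = x0 /\ forall i, V (i + 1) = P i (V i).
Proof.
pose fwd := nat_rect (fun=> S) x0 (fun n x => P n%:Z x).
pose bwd := nat_rect (fun=> S) x0 (fun n x => (P (- n.+1%:Z))^-1%g x).
exists (fun i => if i is Posz n then fwd n else bwd `|i|%N).
split=> // -[n|n]; first by rewrite -PoszD addn1.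
case: n => [|n]; first by rewrite /= permKV.
rewrite (_ : Negz n.+1 + 1 = Negz n); last by lia.
by rewrite /= permKV.
Qed.

Lemma lift_exists y i u :
  exists2 z, sliding_block_code h z = y & window z i l = u.
Proof.
have [V [V0 VS]] := two_sided_orbit (fun j => letter_perm (y (i + j))) u.
pose F j := next_window (V (j - i)) (y j).
have FS j : V (j + 1 - i) = [tuple of behead (F j)].
  rewrite addrAC VS permE /step /F; congr [tuple of behead (next_window _ (y _))].
  by rewrite [i + _]addrC subrK.
pose z : config k.+1 := fun j => thead (F j).
have zF n j : (n <= l)%N -> nth ord0 (F j) n = z (j + n%:Z).
  elim: n j => [|n IHn] j nl; first by rewrite addr0 /z /thead (tnth_nth ord0).
  rewrite -nth_behead -[behead (F j)]/(tval [tuple of behead (F j)]) -FS.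
  have := IHn (j + 1) (ltnW nl); rewrite /F /= nth_rcons size_tuple nl => ->.
  by congr z; lia.
clearbody z; have windowF j : window z j l.+1 = F j.
  by apply: eq_window => n nl; rewrite zF.
exists z; first by apply/funext => j; rewrite /sliding_block_code windowF next_windowE.
apply: eq_window => n nl; rewrite -(zF n i (ltnW nl)) /F /= nth_rcons.
by rewrite size_tuple nl subrr V0.
Qed.

(** The letters read off the concatenated word u v drive u to v. *)
Lemma run_transitive u v : exists w, run u w = v.
Proof.
pose z : config k.+1 := fun i => nth ord0 (u ++ v) `|i|%N.
have zu : window z 0 l = u.
  by apply: eq_window => j jl; rewrite add0r /z nth_cat size_tuple absz_nat jl.
have zv : window z l%:Z l = v.
  apply: eq_window => j jl; rewrite /z nth_cat size_tuple -PoszD absz_nat.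
  by rewrite ltnNge leq_addr addKn.
by have := window_run z 0 l; rewrite add0r zv zu => ->; eexists.
Qed.

(** Preimages of periodic points are periodic, since the state along one period
    evolves by a permutation of a finite set. *)
Lemma lift_periodic z : Defs.periodic (sliding_block_code h z) -> Defs.periodic z.
Proof.
case=> p p0 yp; set y := sliding_block_code h z in yp.
have ypj (j : nat) i : y (i + p%:Z * j%:Z) = y i.
  elim: j => [|j IHj]; first by rewrite mulr0 addr0.
  by rewrite -IHj -[RHS]yp; congr y; lia.
have [P runP] := run_perm [seq y (0 + t%:Z) | t <- iota 0 p].
have ypz (j : int) i : y (i + p%:Z * j) = y i.
  case: j => j; first exact: ypj.
  by rewrite -(ypj j.+1); congr y; rewrite NegzE; lia.
have st (j : int) : window z (p%:Z * (j + 1)) l = P (window z (p%:Z * j) l).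
  rewrite mulrDr mulr1 window_run -runP; congr run; apply: eq_map => t.
  by rewrite -/y addrC ypz add0r.
have stN (n : nat) (j : int) :
    window z (p%:Z * (j + n%:Z)) l = iter n P (window z (p%:Z * j) l).
  elim: n => [|n IHn]; first by rewrite addr0.
  by rewrite iterS -IHn -st; congr (window z _ l); lia.
exists (p * #[P]%g)%N => [|i]; first by rewrite muln_gt0 p0 order_gt0.
pose j := (i %/ p%:Z)%Z; pose r := `|(i %% p%:Z)%Z|%N.
have r0 : 0 <= (i %% p%:Z)%Z by rewrite modz_ge0//; lia.
have iE : i = p%:Z * j + r%:Z by rewrite /r gez0_abs// mulrC -divz_eq.
have := @lift_determined z z (p%:Z * (j + #[P]%g%:Z)) (p%:Z * j) r.+1 _ _ r.
rewrite -iE => <-; last by lia.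
- by congr z; rewrite [LHS]/= {1}iE PoszM; ring.
- by move=> t _; rewrite -/y [_ + t%:Z]addrC ypz addrC [RHS]ypz.
- by rewrite stN -permX expg_order perm1.
Qed.

(** Since run is transitive, pairs of states can be joined one after the other by
    appending letters. A power of the resulting word acts as the identity and
    still has the old prefixes. *)
Lemma covering_word w0 : exists w, [/\ prefix w0 w, forall u, run u w = u &
  forall u v, exists2 n, (n <= size w)%N & run u (take n w) = v].
Proof.
have build (L : seq (state * state)) : exists2 w, prefix w0 w &
    forall uv, uv \in L -> exists2 n, (n <= size w)%N & run uv.1 (take n w) = uv.2.
  elim: L => [|[u v] L [w pw wL]]; first by exists w0; rewrite ?prefix_refl.
  have [w' w'v] := run_transitive (run u w) v.
  exists (w ++ w'); first exact: prefix_catl.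
  move=> uv; rewrite inE => /predU1P[->|/wL[n nw nE]].
    by exists (size (w ++ w')) => //; rewrite take_size run_cat.
  by exists n; [rewrite size_cat; lia|rewrite takel_cat].
have [w pw wP] := build (enum {: state * state}).
have [[|N] // _ wN] := run_order w; exists (flatten (nseq N.+1 w)).
have runN n u : run u (flatten (nseq n w)) = iter n (run^~ w) u.
  by elim: n u => // n IHn u; rewrite /= run_cat IHn -iterSr.
split=> [|u|u v]; first by rewrite /=; exact: prefix_catl.
  by rewrite runN wN.
have [|n nw nE] := wP (u, v); first by rewrite mem_enum.
exists n; first by rewrite /= size_cat (leq_trans nw) ?leq_addr.
by rewrite takel_cat.
Qed.

End Permutative.

(** * Renormalisation of preimages along the levels *)

Section Renormalisation.
Context {k l : nat} (h : block_code k.+1 l.+1) (hP : permutative h).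
Context (s : nat -> seq 'I_k.+1) (xi : config k.+1).
Hypothesis s_ge2 : forall n, (2 <= size (s n))%N.
Hypothesis fill : fills_holes s xi.
Hypothesis s_closed : forall n u, run hP u (s n) = u.
Implicit Types (x z : config k.+1) (n i : nat) (j : int).

Local Notation q n := (size (s n)).+1.
Local Notation len n := (level_period s n).
Local Notation hole n j := (hole_class s n j).

(** As the words s n act trivially, the states right after the holes of level n
    form themselves an orbit driven by the letters in those holes
    (level_state_step): the same situation at a larger scale. *)
Definition level_state z n j := window z (hole n j + 1) l.

Lemma level_stateS z n j : level_state z n.+1 j = level_state z n ((q n)%:Z * j + 1).
Proof. by rewrite /level_state hole_class_succ. Qed.

Lemma hole_classS n j : hole n (j + 1) = hole n j + (len n)%:Z.
Proof. by rewrite /hole_class mulrDr mulr1 addrA. Qed.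

Section Lift.
Context (z : config k.+1).
Hypothesis zxi : sliding_block_code h z = xi.

Let state_digit n j i : (i <= size (s n))%N ->
    (forall j', level_state z n (j' + 1) =
                step hP (xi (hole n (j' + 1))) (level_state z n j')) ->
  level_state z n ((q n)%:Z * j + 1 + i%:Z) =
  run hP (level_state z n ((q n)%:Z * j + 1)) (take i (s n)).
Proof.
move=> + stepn; elim: i => [|i IHi] is_; first by rewrite addr0 take0.
rewrite (take_nth ord0 is_).
rewrite run_rcons.
rewrite -(IHi (ltnW is_)).
rewrite -(fill j is_).
rewrite -[i.+1]addn1 PoszD addrA.
rewrite stepn.
by congr (step hP (xi (hole n _)) _); lia.
Qed.

Lemma level_state_step n j :
  level_state z n (j + 1) = step hP (xi (hole n (j + 1))) (level_state z n j).
Proof.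
elim: n j => [|n IHn] j.
  by rewrite /level_state /hole_class /= !mul1r !add0r (window_step hP) zxi.
rewrite !level_stateS hole_class_succ.
have := @state_digit n j (size (s n)) (leqnn _) IHn.
rewrite take_size s_closed => <-.
by rewrite (_ : _ + (size (s n))%:Z = (q n)%:Z * (j + 1)); last by lia.
Qed.

Lemma level_state_digit n j i : (i <= size (s n))%N ->
  level_state z n ((q n)%:Z * j + 1 + i%:Z) =
  run hP (level_state z n.+1 j) (take i (s n)).
Proof.
by move=> is_; rewrite level_stateS state_digit// => j'; exact: level_state_step.
Qed.

End Lift.

Lemma xi_block n j j' (t : nat) : (t < (len n).-1)%N ->
  xi (hole n j + 1 + t%:Z) = xi (hole n j' + 1 + t%:Z).
Proof.
move=> tn; have /PerP/(_ (j' - j)) <- : Per xi (len n) (hole n j + 1 + t%:Z).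
  apply: (not_hole_run fill).
  rewrite (_ : _ - _ = j * (len n)%:Z + (1 + t%:Z)); last first.
    by rewrite /hole_class; ring.
  by rewrite modzMDl modz_small; lia.
by congr xi; rewrite /hole_class; ring.
Qed.

(** After each hole of level n the sequence xi reads the same word up to the next
    one, so there a preimage depends on its state only. *)
Lemma level_block z z' n j j' :
    sliding_block_code h z = xi -> sliding_block_code h z' = xi ->
    level_state z n j = level_state z' n j' ->
  forall t, (t < (len n).-1 + l)%N ->
    z (hole n j + 1 + t%:Z) = z' (hole n j' + 1 + t%:Z).
Proof.
move=> zxi z'xi st t tl; apply: (lift_determined hP _ st) tl => t' t'n.
by rewrite zxi z'xi; exact: xi_block.
Qed.

(** The image of a word of x occurs in xi, and there it can be lifted to a preimage
    of xi from the state of x. Statements about the words of the preimage of the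
    orbit closure thus reduce to preimages of xi. *)
Lemma preimage_word x (N : nat) : language_subshift xi (sliding_block_code h x) ->
  forall i0 : int, exists z (i' : int), sliding_block_code h z = xi /\
    forall t, (t < N)%N -> x (i0 + t%:Z) = z (i' + t%:Z).
Proof.
move=> /language_subshiftP Lx i0.
have [n xn] := Lx (`|i0| + N).+1.
have [z zxi zw] := lift_exists hP xi (i0 + n) (window x i0 l).
exists z, (i0 + n); split=> // t tN.
apply: (lift_determined hP (n := N)); [move=> t' t'N|exact/esym|lia].
by rewrite zxi xn ?/shift_iter; [congr xi|]; lia.
Qed.

Lemma hole_floor n (i : int) : exists j, hole n j <= i < hole n (j + 1).
Proof.
have L0 := level_period_gt0 s n.
exists ((i - (level_hole s n)%:Z) %/ (len n)%:Z)%Z; rewrite hole_classS /hole_class.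
have := divz_eq (i - (level_hole s n)%:Z) (len n)%:Z.
have := modz_ge0 (i - (level_hole s n)%:Z) (_ : (len n)%:Z != 0).
have := @ltz_pmod (i - (level_hole s n)%:Z) (len n)%:Z.
move: (_ %/ _)%Z (_ %% _)%Z => d r; rewrite mulrC; lia.
Qed.

Hypothesis s_covers : forall n u v,
  exists2 i, (i <= size (s n))%N & run hP u (take i (s n)) = v.

(** A word of x' fits between two holes of level n of some preimage of xi,
    starting in some state; every preimage attains that state within each period
    of level n.+1 and then repeats the word. *)
Lemma preimage_minimal :
  minimal (sliding_block_code h @^-1` language_subshift xi).
Proof.
move=> x Lx x' Lx'; apply/closure_orbit_agree => M.
have [z [i' [zxi zx']]] := preimage_word (M + M) Lx' (- M%:Z).
pose n := (`|i'| + (M + M)).+1.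
have noh (i : int) j : i' <= i <= i' + (M + M)%N%:Z -> i <> hole n j.
  by move=> ii; apply: hole_class_escape => //; lia.
have [j /andP[ji ij]] := hole_floor n i'.
have ji' : hole n j < i' by have := noh i' j; lia.
have ij' : i' + (M + M)%N%:Z < hole n (j + 1) by have := noh (hole n (j + 1)) (j + 1); lia.
have [z2 [i2 [z2xi z2x]]] := preimage_word (len n.+1 + len n.+1 + l) Lx 0.
have [j2 /andP[j2i i2j]] := hole_floor n.+1 i2.
have [i iq iE] := s_covers n (level_state z2 n.+1 (j2 + 1)) (level_state z n j).
have st := level_state_digit z2xi (j2 + 1) iq; rewrite iE in st.
set j3 := (q n)%:Z * (j2 + 1) + 1 + i%:Z in st.
exists (hole n j3 - hole n j + i' - i2 + M%:Z) => m mM.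
have -> : x' m = z (hole n j + 1 + (i' + m + M%:Z - hole n j - 1)).
  rewrite (_ : x' m = x' (- M%:Z + `|(m + M%:Z)%R|%N%:Z)); last by congr x'; lia.
  by rewrite zx'; [congr z|]; lia.
rewrite hole_classS in ij'.
have j3E : hole n j3 = hole n.+1 (j2 + 1) + (len n)%:Z * i%:Z.
  by rewrite hole_class_succ /j3 /hole_class; ring.
have iL : (len n * i <= len n * size (s n))%N by rewrite leq_mul2l iq orbT.
have LE : (len n.+1 = len n + len n * size (s n))%N by rewrite /= mulnS.
rewrite hole_classS in i2j j3E.
rewrite -[i' + m + _ - _ - 1]gez0_abs; last by lia.
rewrite -(level_block z2xi zxi st); last by lia.
rewrite /shift_iter -[X in _ = x X]add0r -[X in 0 + X]gez0_abs; last by lia.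
by rewrite z2x; [congr z2|]; lia.
Qed.

End Renormalisation.

(** * Unique ergodicity from equal level words *)

Section VisitCounts.
Context {kappa : nat} (C : set (config kappa)).
Implicit Types (x y z : config kappa).

Lemma visits_mono x (a N N' : nat) : (a + N <= N')%N ->
  (visits C (shift_iter a%:Z x) N <= visits C x N')%N.
Proof.
move=> aN; rewrite -(subnKC aN) -addnA visits_cat visits_cat.
by rewrite (leq_trans _ (leq_addl _ _))// leq_addr.
Qed.

Lemma visits_blocks x (L m : nat) : visits C x (m * L) =
  (\sum_(i < m) visits C (shift_iter (i * L)%N%:Z x) L)%N.
Proof.
elim: m => [|m IHm]; first by rewrite big_ord0 mul0n /visits big_ord0.
by rewrite big_ord_recr/= -IHm mulSnr visits_cat.
Qed.

Context (M : nat).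
Hypothesis MC : forall x y, agree M x y -> C x -> C y.

Lemma visits_agree x y (N : nat) :
    (forall i : int, - M%:Z <= i < N%:Z + M%:Z -> x i = y i) ->
  visits C x N = visits C y N.
Proof.
move=> xy; apply: eq_bigr => t _; congr nat_of_bool; apply: asbool_equiv_eq.
have tag : agree M (shift_iter t%:Z x) (shift_iter t%:Z y).
  by move=> i iM; apply: xy; have := ltn_ord t; lia.
by split; apply: MC => //; exact: agree_sym.
Qed.

(* only the first M and the last M times see beyond the window from 0 to L - 1 *)
Lemma visits_close x y (L : nat) :
    (forall t : nat, (t < L)%N -> x t%:Z = y t%:Z) ->
  (visits C x L <= visits C y L + 2 * M)%N.
Proof.
move=> xy; have [LM|ML] := ltnP L (2 * M).
  by rewrite (leq_trans (visits_le _ _ _))//; lia.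
have -> : L = (M + ((L - 2 * M) + M))%N by lia.
rewrite !visits_cat !shift_iterD.
have := visits_le C x M; have := visits_le C (shift_iter ((L - 2 * M)%N%:Z + M%:Z) x) M.
rewrite (@visits_agree (shift_iter M%:Z x) (shift_iter M%:Z y)); first by lia.
by move=> i iM; rewrite /shift_iter -[i + _]gez0_abs; [apply: xy|]; lia.
Qed.

End VisitCounts.

(** By invariance N * mu C is the integral over X of the number of visits. *)
Lemma invariant_visits_bounds (R : realType) (k : nat) (X : set (config k.+1))
    (mu : probability (borel_config k) R) (C : set (config k.+1)) (N a b : nat) :
    invariant_probability X mu -> local C -> @measurable _ (borel_config k) X ->
    (forall x, X x -> (a <= visits C x N <= b)%N) ->
  (a%:R <= N%:R * fine (mu C) <= b%:R)%R.
Proof.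
move=> [muX inv] lC mX ab.
pose A (t : nat) : set (borel_config k) := shift_iter t%:Z @^-1` C.
have mA t : measurable (A t) by apply: local_measurable; exact: local_shift.
have muA t : mu (A t) = mu C.
  elim: t => [|t IHt].
    by congr (mu _); apply/funext => x; rewrite /A /preimage/= shift_iter0.
  rewrite -IHt -[RHS]inv; last exact: mA.
  congr (mu _); apply/funext => x; rewrite /A /preimage/= /Defs.shift shift_iterD.
  by rewrite -[t.+1]addn1 PoszD.
have muXC : mu (~` X) = 0%E by rewrite probability_setC// muX subee.
have mXC : @measurable _ (borel_config k) (~` X) by exact: measurableC.
have muAX t : mu (A t `&` X) = mu C.
  rewrite -(muA t) [RHS](measureDI mu (mA t) mX) [X in (X + _)%E](_ : _ = 0%E) ?add0e//.
  apply: (@subset_measure0 _ (borel_config k) R mu _ (~` X)) => //.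
  exact: measurableD.
have fC : mu C = (fine (mu C))%:E.
  by rewrite fineK// fin_num_measure//; exact: local_measurable.
pose f (t : nat) (x : borel_config k) : \bar R := (\1_(A t) x)%:E.
have f0 t x : X x -> (0%E <= f t x)%E by move=> _; rewrite lee_fin.
have mf t : @measurable_fun _ _ (borel_config k) _ X (f t).
  by apply/measurable_EFinP; exact: measurable_indic.
have visitsE x : ((visits C x N)%:R%:E = \sum_(t <- iota 0 N) f t x)%E.
  rewrite /visits natr_sum -sumEFin -(big_mkord xpredT (fun t => ((`[< C (shift_iter t%:Z x) >] : nat)%:R)%:E)).
  by rewrite /index_iota subn0; apply: eq_bigr => t _; rewrite /f indicE.
have sumE : (\int[mu]_(x in X) (\sum_(t <- iota 0 N) f t x) =
    (N%:R * fine (mu C))%:E)%E.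
  rewrite (ge0_integral_sum mu mX mf f0).
  rewrite (eq_bigr (fun=> (fine (mu C))%:E)); last first.
    by move=> t _; rewrite /f integral_indic//; exact: etrans (muAX t) fC.
  by rewrite sumEFin big_const_seq count_predT size_iota iter_addr_0 mulr_natl.
have ms := @emeasurable_sum _ (borel_config k) R X nat (iota 0 N) f mf.
have cstE (c : nat) : (\int[mu]_(x in X) (cst c%:R%:E x) = c%:R%:E)%E.
  by rewrite integral_cst//; exact: etrans (congr1 (mule _) muX) (mule1 _).
apply/andP; split; rewrite -lee_fin -sumE -cstE; apply: ge0_le_integral => //=.
- by move=> x /ab/andP[? _]; rewrite -visitsE lee_fin ler_nat.
- by move=> x _; rewrite -visitsE lee_fin.
- by move=> x /ab/andP[_ ?]; rewrite -visitsE lee_fin ler_nat.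
Qed.

Section LevelVisits.
Context {k : nat} (s : nat -> seq 'I_k.+1) (C : set (config k.+1)).

Definition level_visits (z : config k.+1) n (j : int) :=
  visits C (shift_iter (hole_class s n j + 1) z) (level_period s n).

Lemma level_visitsS z n j : level_visits z n.+1 j =
  (\sum_(i < (size (s n)).+1) level_visits z n ((size (s n)).+1%:Z * j + 1 + i%:Z))%N.
Proof.
rewrite /level_visits /= [(level_period s n * _)%N]mulnC visits_blocks.
apply: eq_bigr => i _; rewrite shift_iterD; congr (visits C (shift_iter _ z) _).
by rewrite hole_class_succ /hole_class PoszM; ring.
Qed.

End LevelVisits.

Section UniqueErgodicity.
Context {k l : nat} (h : block_code k.+1 l.+1) (hP : permutative h).
Context (w : seq 'I_k.+1) (xi : config k.+1).
Local Notation s := (fun _ : nat => w).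
Hypothesis w_ge2 : (2 <= size w)%N.
Hypothesis fill : fills_holes s xi.
Hypothesis w_closed : forall u, run hP u w = u.
Hypothesis w_covers : forall u v,
  exists2 i, (i <= size w)%N & run hP u (take i w) = v.
Implicit Types (x z : config k.+1) (n i : nat) (j : int) (C : set (config k.+1)).

Local Notation len n := (level_period s n).
Local Notation hole n j := (hole_class s n j).
Local Notation lift z := (sliding_block_code h z = xi).

Lemma level_period_const n : len n = ((size w).+1 ^ n)%N.
Proof. by elim: n => [//|n /= ->]; rewrite expnSr. Qed.

Section Visits.
Context (C : set (config k.+1)) (M : nat).
Hypothesis MC : forall x y, agree M x y -> C x -> C y.

Local Notation level_visits := (level_visits s C).

Lemma level_visits_close z z' n j j' : lift z -> lift z' ->
    level_state (l := l) s z n j = level_state s z' n j' ->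
  (level_visits z n j <= level_visits z' n j' + (2 * M).+1)%N.
Proof.
move=> lz lz' st; rewrite /level_visits; have L0 := level_period_gt0 s n.
have last y : visits C y (len n) =
    (visits C y (len n).-1 + visits C (shift_iter (len n).-1 y) 1)%N.
  by rewrite -visits_cat addn1 (ltn_predK L0).
have last1 := visits_le C (shift_iter (len n).-1 (shift_iter (hole n j + 1) z)) 1.
rewrite !last.
have agr (t : nat) : (t < (len n).-1)%N ->
    shift_iter (hole n j + 1) z t%:Z = shift_iter (hole n j' + 1) z' t%:Z.
  move=> tL; rewrite /shift_iter ![t%:Z + _]addrC.
  by apply: (level_block hP fill lz lz' st); rewrite ltn_addr.
have := visits_close MC agr; lia.
Qed.

(** Among the (size w).+1 blocks of level n in a block of level n.+1, one starts
    in a fixed reference state, and its visit count is known up to a constant.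
    Hence the spread of the visit counts grows by a factor size w only, while the
    period grows by the factor (size w).+1. *)
Lemma level_visits_bounds n : exists A e : nat,
  (e + 2 * (2 * M).+1 <= (1 + 2 * (2 * M).+1) * size w ^ n)%N /\
  forall z j, lift z -> (A <= level_visits z n j <= A + e)%N.
Proof.
set D := (2 * M).+1; elim: n => [|n [A [e [eE Ae]]]].
  exists 0%N, 1%N; split=> [|z j _]; first by rewrite expn0; lia.
  by rewrite (leq_trans (visits_le _ _ _)).
have [z0 z0xi _] := lift_exists hP xi 0 [tuple ord0 | _ < l].
set g := level_visits z0 n 0.
exists ((g - D) + size w * A)%N, (2 * D + size w * e)%N; split.
  rewrite expnS; have : (2 * (2 * D) <= size w * (2 * D))%N by rewrite leq_mul2r w_ge2 orbT.
  have : (size w * (e + 2 * D) <= size w * ((1 + 2 * D) * size w ^ n))%N.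
    by rewrite leq_mul2l eE orbT.
  by rewrite mulnDr mulnCA; lia.
move=> z j lz; have [i is_ iE] := w_covers (level_state s z n.+1 j) (level_state s z0 n 0).
have := level_state_digit fill (fun _ => w_closed) lz j is_ => /(_ n); rewrite iE => st.
have g1 := level_visits_close lz z0xi st; have g2 := level_visits_close z0xi lz (esym st).
rewrite level_visitsS (bigD1 (inord i))//= inordK ?ltnS//.
set S := (\sum_(_ < _ | _) _)%N.
have constS (c : nat) : (size w * c = \sum_(i' < (size w).+1 | i' != inord i) c)%N.
  by rewrite sum_nat_const cardC1 card_ord.
have SA : (size w * A <= S)%N.
  rewrite constS /S; apply: leq_sum => i' _.
  by have /andP[] := Ae z ((size w).+1%:Z * j + 1 + i'%:Z) lz.
have SAe : (S <= size w * (A + e))%N.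
  rewrite constS /S; apply: leq_sum => i' _.
  by have /andP[] := Ae z ((size w).+1%:Z * j + 1 + i'%:Z) lz.
by rewrite mulnDr in SAe; move: g1 g2; rewrite -/g -/D; lia.
Qed.

(** An orbit segment of length m * len n contains m - 1 complete blocks of level
    n and is contained in m + 1 of them. *)
Lemma visits_bounds n : exists A e : nat, [/\ (A <= len n)%N,
  (e <= (1 + 2 * (2 * M).+1) * size w ^ n)%N &
  forall x m, language_subshift xi (sliding_block_code h x) ->
    (m.-1 * A <= visits C x (m * len n) <= m.+1 * (A + e))%N].
Proof.
have [A [e [eE Ae]]] := level_visits_bounds n; exists A, e.
split=> [||x m Lx]; [|by lia|].
  have [z0 z0xi _] := lift_exists hP xi 0 [tuple ord0 | _ < l].
  have /andP[Ab _] := Ae z0 0 z0xi; apply: leq_trans Ab _.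
  exact: visits_le.
have [z [i0 [lz zx]]] := preimage_word hP (M + (m * len n) + M) Lx (- M%:Z).
have -> : visits C x (m * len n) = visits C (shift_iter (i0 + M%:Z) z) (m * len n).
  apply: (visits_agree MC) => i iM; rewrite /shift_iter.
  rewrite (_ : i = - M%:Z + `|(i + M%:Z)%R|%N%:Z); last by lia.
  by rewrite zx; [congr z|]; lia.
have blocks j' m' : visits C (shift_iter (hole n j' + 1) z) (m' * len n) =
    (\sum_(i < m') level_visits z n (j' + i%:Z))%N.
  rewrite visits_blocks; apply: eq_bigr => i _; rewrite shift_iterD.
  by congr (visits C (shift_iter _ z) _); rewrite /hole_class PoszM; ring.
have constm (m' c : nat) : (m' * c = \sum_(i < m') c)%N.
  by rewrite sum_nat_const card_ord.
have [j /andP[ji ij]] := hole_floor s n (i0 + M%:Z - 1).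
rewrite hole_classS in ij; apply/andP; split.
  apply: (@leq_trans (visits C (shift_iter (hole n (j + 1) + 1) z) (m.-1 * len n))).
    by rewrite blocks constm; apply: leq_sum => i _; have /andP[] := Ae z (j + 1 + i%:Z) lz.
  case: m {zx} => [|m]; first by rewrite !mul0n /visits !big_ord0.
  rewrite (_ : shift_iter _ z = shift_iter `|(hole n (j + 1) - (i0 + M%:Z - 1))%R|%N%:Z
     (shift_iter (i0 + M%:Z) z)); last first.
    by rewrite shift_iterD; congr (shift_iter _ z); rewrite hole_classS; lia.
  by apply: visits_mono; rewrite hole_classS mulSn/=; lia.
apply: (@leq_trans (visits C (shift_iter (hole n j + 1) z) (m.+1 * len n))); last first.
  by rewrite blocks constm; apply: leq_sum => i _; have /andP[] := Ae z (j + i%:Z) lz.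
rewrite (_ : shift_iter (i0 + _) z = shift_iter `|(i0 + M%:Z - 1 - hole n j)%R|%N%:Z
   (shift_iter (hole n j + 1) z)); last first.
  by rewrite shift_iterD; congr (shift_iter _ z); lia.
by apply: visits_mono; rewrite mulSn; lia.
Qed.

End Visits.

Local Notation X := (sliding_block_code h @^-1` language_subshift xi).

Lemma preimage_measurable : @measurable _ (borel_config k) X.
Proof.
have cX : closed X by apply: closed_sliding_preimage; exact: closed_language_subshift.
rewrite -[X in measurable X]setCK; apply: measurableC; apply: sub_sigma_algebra.
by rewrite openC.
Qed.

Lemma invariant_probability_unique (R : realType)
    (mu nu : probability (borel_config k) R) :
    invariant_probability X mu -> invariant_probability X nu ->
  forall A : set (borel_config k), measurable A -> mu A = nu A.
Proof.
move=> imu inu; apply: probability_local_unique => C lC.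
have finC (m : probability (borel_config k) R) : m C = (fine (m C))%:E.
  by rewrite fineK// fin_num_measure//; exact: local_measurable.
rewrite finC [RHS]finC; congr EFin; apply/eqP; rewrite -subr_eq0 -normr_le0.
have [M MC] := lC; set B := (1 + 2 * (2 * M).+1)%N; set r := size w.
pose u n : R := 2 * n.+1%:R^-1 + 2 * B%:R * (r%:R / r.+1%:R) ^+ n.
have u0 : u @ \oo --> (0 : R).
  rewrite -[X in _ --> X](addr0 0) -[X in X + _](mulr0 2) -[X in _ + X](mulr0 (2 * B%:R)).
  apply: cvgD; apply: cvgMr; first exact: cvg_harmonic.
  apply: cvg_expr; rewrite ger0_norm// ltr_pdivrMr// mul1r ltr_nat //.
apply: (cvgr_to_ge u0); apply: nearW => n.
have [A [e [AL eE bd]]] := visits_bounds MC n.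
have bmu : forall x, X x -> (n * A <= visits C x (n.+1 * len n) <= n.+2 * (A + e))%N.
  by move=> x Lx; exact: (bd x n.+1 Lx).
have := invariant_visits_bounds inu lC preimage_measurable bmu.
have := invariant_visits_bounds imu lC preimage_measurable bmu.
move: (fine (mu C)) (fine (nu C)) => c d.
rewrite level_period_const [(n.+1 * _)%:R]natrM natrX -/r => cb db.
have L0 : 0 < r.+1%:R ^+ n :> R by rewrite exprn_gt0.
have n0 : 0 < n.+1%:R :> R by [].
have eE' : e%:R <= B%:R * r%:R ^+ n :> R by rewrite -natrX -natrM ler_nat.
have AL' : A%:R <= r.+1%:R ^+ n :> R by rewrite -natrX -level_period_const ler_nat.
have P0 := mulr_gt0 n0 L0.
have uE : n.+1%:R * r.+1%:R ^+ n * u n =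
   2 * r.+1%:R ^+ n + 2 * n.+1%:R * (B%:R * r%:R ^+ n).
  rewrite /u expr_div_n; field; rewrite gt_eqF//=; exact: gt_eqF.
have key : n.+2%:R * (A%:R + e%:R) - n%:R * A%:R <=
    2 * r.+1%:R ^+ n + 2 * n.+1%:R * (B%:R * r%:R ^+ n) :> R.
  have -> : n.+2%:R * (A%:R + e%:R) - n%:R * A%:R = 2 * A%:R + n.+2%:R * e%:R :> R.
    by rewrite -addn2 natrD; ring.
  apply: lerD; first by rewrite ler_pM2l.
  apply: ler_pM => //; rewrite -natrM ler_nat; lia.
move: cb db; rewrite !natrM !natrD => /andP[c1 c2] /andP[d1 d2].
by rewrite ler_norml lerNl opprB; apply/andP; split;
  rewrite -(ler_pM2l P0) mulrBr uE; lra.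
Qed.

Lemma preimage_uniquely_ergodic (R : realType) : uniquely_ergodic R X.
Proof.
have cX : closed X by apply: closed_sliding_preimage; exact: closed_language_subshift.
have [z zxi _] := lift_exists hP xi 0 [tuple ord0 | _ < l].
have [i t|n|mu [imu _]] := @krylov_bogoliubov R k X (fun=> z) succn cX.
- by rewrite /preimage /= sliding_shift zxi; apply: language_subshift_shift.
- exact: ltnSn.
by exists mu => // nu inu A mA; exact: invariant_probability_unique.
Qed.

End UniqueErgodicity.

(** * Strictly ergodic and non-minimal preimages for every permutative code *)

Lemma fills_holes_regular (R : realType) (k : nat) (s : nat -> seq 'I_k.+1)
    (xi : config k.+1) :
    (forall n, (2 <= size (s n))%N) -> fills_holes s xi ->
    (forall n, exists i i', [/\ (i < size (s n))%N, (i' < size (s n))%N &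
       nth ord0 (s n) i != nth ord0 (s n) i']) ->
  regular_toeplitz_subshift R (language_subshift xi).
Proof.
move=> s_ge2 fill s_letters.
have nper := fills_holes_not_periodic s_ge2 fill s_letters.
have L3 n : (3 * level_period s n <= level_period s n.+1)%N by exact: level_periodS.
have L0 n := level_period_gt0 s n.
have [txi rxi] : toeplitz xi /\ Defs.regular R xi.
  apply: (@toeplitz_regular_run _ R xi (fun n => level_period s n.+1)
    (fun n => (level_hole s n.+1)%:Z) 1 nper) => //.
  - by move=> n; have := L3 n.+1; have := L0 n.+1; lia.
  - by move=> n; exact: level_period_dvdS.
  - by move=> n; have := L3 n; have := L0 n; lia.
  - by move=> n m; exact: not_hole_run.
  - by move=> m; exists `|m|%N; apply: escape_run.
by split; [exists xi|exists xi; split].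
Qed.

(** The same covering word at all levels makes the preimage minimal and makes
    the visit counts of its blocks equalise. *)
Lemma exists_strictly_ergodic_preimage (R : realType) (k l : nat)
    (h : block_code k.+2 l.+1) : permutative h ->
  exists2 Y : set (config k.+2), regular_toeplitz_subshift R Y &
    strictly_ergodic R (sliding_block_code h @^-1` Y).
Proof.
move=> hP; have [w [pw w_closed w_covers]] := covering_word hP [:: ord0; ord_max].
have w_ge2 : (2 <= size w)%N by have := size_prefix pw.
have [xi fill] := fills_holes_exists (fun=> w).
exists (language_subshift xi).
  apply: (fills_holes_regular R _ fill) => // _; exists 0%N, 1%N; split=> //.
    exact: ltnW.
  by move: pw => /prefixP[w' ->].
split; first exact: (preimage_minimal _ fill (fun=> w_closed) (fun=> w_covers)).
exact: (preimage_uniquely_ergodic w_ge2 fill w_closed w_covers).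
Qed.

Lemma Per_sliding (kappa ell : nat) (h : block_code kappa ell) (x : config kappa)
    (p : nat) (m : int) :
    (forall t : nat, (t < ell)%N -> Per x p (m + t%:Z)) ->
  Per (sliding_block_code h x) p m.
Proof.
move=> per; apply/PerP => j; congr h; apply: eq_from_tnth => t.
rewrite !tnth_mktuple; have /PerP/(_ j) <- := per _ (ltn_ord t).
by congr x; rewrite addrAC.
Qed.

(** If translates of x converge to a preimage x' of sliding_block_code h x, then
    the times of return are multiples of the essential periods p i, so x' agrees
    with x at all p i-periodic positions of x. *)
Lemma other_lift_not_minimal (kappa ell : nat) (h : block_code kappa ell)
    (x x' : config kappa) (p : nat -> nat) :
    let y := sliding_block_code h x in
    sliding_block_code h x' = y -> x' <> x ->
    (forall i, essential_period y (p i)) -> \bigcup_i Per x (p i) = setT ->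
  ~ minimal (sliding_block_code h @^-1` language_subshift y).
Proof.
move=> y x'y x'x ess cover mini; apply: x'x; apply/funext => m.
have ret : forall M, exists n, agree M x' (shift_iter n x).
  apply/closure_orbit_agree; apply: mini; last by rewrite /preimage/= x'y.
  by rewrite /preimage /=; exact: language_subshift_refl.
have [i _ /PerP xm] : (\bigcup_i Per x (p i)) m by rewrite cover.
have [p0 _ _] := ess i.
have [c cP] := return_class p0 ret.
have /dvdnP[d cE] : (p i %| c)%N.
  apply: (essential_period_return (ess i)) => M.
  have [j cj] := cP (M + ell)%N; exists j.
  by have := agree_sliding h cj; rewrite x'y sliding_shift.
have [j ->] := cP `|m|.+1; last by lia.
by rewrite -(xm (d%:Z + j)) /shift_iter; congr x; rewrite cE PoszM; ring.
Qed.

(** Let y be the image of a Toeplitz sequence x with one hole per period. Per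
    period, y can fail to be periodic on a run of l.+2 positions at most; such a
    run is short compared with the periods of all but the first levels, which are
    therefore essential for y. *)
Lemma exists_not_minimal_preimage (R : realType) (k l : nat)
    (h : block_code k.+2 l.+2) : permutative h ->
  exists2 Y : set (config k.+2), regular_toeplitz_subshift R Y &
    ~ minimal (sliding_block_code h @^-1` Y).
Proof.
move=> hP; pose s (_ : nat) : seq 'I_k.+2 := [:: ord0; ord_max].
have s_ge2 n : (2 <= size (s n))%N by [].
have [x fill] := fills_holes_exists s.
have nperx : ~ Defs.periodic x.
  apply: (fills_holes_not_periodic s_ge2 fill) => n.
  by exists 0%N, 1%N.
pose y := sliding_block_code h x.
have npery : ~ Defs.periodic y by move=> /(lift_periodic hP).
(* the first levels, whose periods are too short for the runs, are skipped *)
pose lev i := (i + 2 * l.+2)%N.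
pose p i := level_period s (lev i); pose c i := (level_hole s (lev i))%:Z - l.+1%:Z.
have L0 n := level_period_gt0 s n.
have p2 i : (2 * l.+2 <= p i)%N.
  by have [] := level_hole_bounds s_ge2 (lev i); rewrite /p /lev; lia.
have p0 i : (p i)%:Z != 0 by have := p2 i; lia.
have run i m : (l.+2)%:Z <= ((m - c i) %% (p i)%:Z)%Z -> Per y (p i) m.
  move=> mr; apply: Per_sliding => t tl; apply: (not_hole_run fill); rewrite -/(p i).
  have r0 := modz_ge0 (m - c i) (p0 i).
  have rp := @ltz_pmod (m - c i) (p i)%:Z.
  have := divz_eq (m - c i) (p i)%:Z.
  move: (_ %/ _)%Z (_ %% _)%Z mr r0 rp => d r mr r0 rp mE.
  rewrite (_ : m + t%:Z - _ = d * (p i)%:Z + (r + t%:Z - l.+1%:Z)); last first.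
    by rewrite -[m](subrK (c i)) mE /c; ring.
  by rewrite modzMDl modz_small; have := p2 i; lia.
have cover m : (l.+2)%:Z <= ((m - c `|m|%N) %% (p `|m|%N)%:Z)%Z.
  rewrite leNgt; apply/negP; set r := (_ %% _)%Z => rl.
  have r0 : 0 <= r by exact: modz_ge0 (p0 _).
  have mE := divz_eq (m - c `|m|%N) (p `|m|%N)%:Z; rewrite -/r in mE.
  set d := (_ %/ _)%Z in mE.
  (* otherwise the window of length l.+2 at m contains the hole of index d *)
  apply: (@hole_class_escape _ s s_ge2 (lev `|m|%N) (m + (l.+1%:Z - r)) _ d).
    by rewrite /lev; lia.
  rewrite /hole_class -/(p `|m|%N) mulrC.
  have -> : d * (p `|m|%N)%:Z = m - c `|m|%N - r by rewrite mE addrK.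
  by rewrite /c; ring.
have [ty ry] : toeplitz y /\ Defs.regular R y.
  apply: (@toeplitz_regular_run _ R y p c l.+2 npery) => //.
  - move=> i; have := level_periodS s_ge2 (lev i); have := L0 (lev i).
    by rewrite /p /lev addSn; lia.
  - by move=> i; rewrite /p /lev addSn; exact: level_period_dvdS.
  - by move=> m; exists `|m|%N.
exists (language_subshift y); first by split; [exists y|exists y; split].
pose f (a : 'I_k.+2) : 'I_k.+2 := if a == ord0 then ord_max else ord0.
have f_neq a : f a <> a.
  by rewrite /f; case: ifPn => [/eqP -> /(congr1 val)|/eqP a0 aE] //; apply: a0.
have [x' x'y x'u] := lift_exists hP y 0 (map_tuple f (window x 0 l.+1)).
apply: (other_lift_not_minimal (p := p) x'y).
- move=> xx; have := congr1 (fun t => tnth t ord0) x'u.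
  by rewrite xx (tnth_map f) => /esym; apply: f_neq.
- by move=> i; apply: (essential_period_run (c := c i) npery _ (p2 i)) (run i).
- apply/seteqP; split=> // m _; exists `|m|%N => //.
  by apply: (not_hole_run fill); apply: (escape_run s_ge2); rewrite /lev; lia.
Qed.

(** * Difference codes over a given Toeplitz subshift *)

Section DifferenceCode.
Context {k p : nat} (p0 : (0 < p)%N) (a : 'I_k.+1).

Definition difference_code : block_code k.+1 p.+1 :=
  fun t => tnth t ord_max - tnth t ord0 + a.

Lemma difference_code_permutative : permutative difference_code.
Proof.
move=> u; split.
  have fE b : difference_code [tuple of rcons u b] = b - nth ord0 u 0 + a.
    rewrite /difference_code !(tnth_nth ord0) /= !nth_rcons size_tuple ltnn eqxx.
    by rewrite p0.
  exists (fun c => c - a + nth ord0 u 0) => b; rewrite fE.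
    by rewrite addrK subrK.
  by rewrite addrK subrK.
have fE b : difference_code [tuple of b :: u] = nth ord0 u p.-1 - b + a.
  rewrite /difference_code !(tnth_nth ord0) /=; congr (_ - _ + _).
  by move: (tval u) => v; rewrite -{1}(prednK p0).
exists (fun c => nth ord0 u p.-1 - (c - a)) => b; rewrite fE.
  by rewrite addrK opprB addrC subrK.
by rewrite opprB [nth _ _ _ + _]addrC !subrK.
Qed.

(** Where xi is p-periodic with value a, a preimage is p-periodic, and its value
    there can be prescribed through its first p letters. *)
Lemma difference_code_lift (xi : config k.+1) (b : 'I_k.+1) :
  exists2 x, sliding_block_code difference_code x = xi &
    forall m, Per_letter xi p a m -> x m = b.
Proof.
have [x xxi x0] := lift_exists difference_code_permutative xi 0 [tuple b | _ < p].
exists x => // m am.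
have step m' : xi m' = a -> x (m' + p%:Z) = x m'.
  rewrite -xxi /sliding_block_code /difference_code !tnth_mktuple /= addr0 => e.
  by apply/eqP; rewrite -subr_eq0; apply/eqP; apply: (addIr a); rewrite add0r.
have steps m' (n : nat) : Per_letter xi p a m' -> x (m' + p%:Z * n%:Z) = x m'.
  move=> am'; elim: n => [|n <-]; first by rewrite mulr0 addr0.
  rewrite -[RHS]step; first by congr x; rewrite -[n.+1]addn1 PoszD; ring.
  by rewrite mulrC; exact: am'.
have p0' : p%:Z != 0 by lia.
pose r := (m %% p%:Z)%Z; pose d := (m %/ p%:Z)%Z.
have mE : m = r + p%:Z * d by rewrite addrC mulrC -divz_eq.
have r0 : 0 <= r by exact: modz_ge0.
have rp : r < p%:Z by apply: ltz_pmod; lia.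
have <- : x r = b.
  have rp' : (`|r| < p)%N by lia.
  have := congr1 (fun t => tnth t (Ordinal rp')) x0; rewrite !tnth_mktuple /= => <-.
  by congr x; lia.
have ar : Per_letter xi p a r.
  by move=> j; rewrite -(am (j - d)) mE; congr xi; ring.
case: d mE => [d|d] mE; first by rewrite mE steps.
by rewrite -(steps m d.+1 am) mE; congr x; rewrite NegzE; ring.
Qed.

End DifferenceCode.

(** Choose p and a such that Per_letter xi p a contains 0, and let x and x' be the
    preimages of xi equal to ord0 and to ord_max on this set. If translates of x
    by times in c + p Z converge to x', then - c belongs to this set, because xi
    carries along - c + p Z what it carries along p Z. So x' has the letter
    ord_max at - c, whereas the limit gives it the letter ord0. *)
Lemma toeplitz_subshift_not_minimal_preimage (k : nat) (Y : set (config k.+1)) :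
  toeplitz_subshift Y ->
  exists (l : nat) (h : block_code k.+1 l.+1),
    permutative h /\ ~ minimal (sliding_block_code h @^-1` Y).
Proof.
move=> [xi [nper txi] ->]; have [p p0 pP] := txi 0.
have k0 : (0 < k)%N.
  rewrite lt0n; apply/eqP => k0; apply: nper; exists 1%N => // n.
  apply/val_inj => /=; have := ltn_ord (xi n); have := ltn_ord (xi (n + 1%:Z)).
  by rewrite {2 4}k0; lia.
exists p, (difference_code (xi 0)).
have hP := difference_code_permutative p0 (xi 0); split=> // mini.
have [x xxi xP] := difference_code_lift p0 (xi 0) xi ord0.
have [x' x'xi x'P] := difference_code_lift p0 (xi 0) xi ord_max.
have ret : forall M, exists n, agree M x' (shift_iter n x).
  apply/closure_orbit_agree; apply: mini; rewrite /preimage /= ?xxi ?x'xi;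
  exact: language_subshift_refl.
have [c cP] := return_class p0 ret.
have am : Per_letter xi p (xi 0) (- c%:Z).
  move=> j; pose M := (`|(- c%:Z + j * p%:Z)%R|.+1 + p.+1)%N.
  have [i /(agree_sliding (M := `|(- c%:Z + j * p%:Z)%R|.+1) (difference_code (xi 0)))] := cP M.
  rewrite sliding_shift xxi x'xi => -> ; last by lia.
  by rewrite -(pP (j + i)) /shift_iter; congr xi; ring.
have [i ci] := cP c.+1; have := ci (- c%:Z); rewrite x'P//.
rewrite /shift_iter (_ : - c%:Z + _ = p%:Z * i); last by lia.
rewrite xP => [/(_ _)/(congr1 val)/= k_0|j]; first by have := k_0 _; lia.
by rewrite -(pP (i + j)); congr xi; ring.
Qed.

(** * A minimal preimage with two invariant measures *)

Section SumCode.

Definition sum_code : block_code 2 2 := fun t => tnth t ord0 + tnth t ord_max.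

Lemma ord2_neg (a : 'I_2) : - a = a.
Proof. by apply/val_inj; case: a => [[|[|]]]. Qed.

Lemma sum_code_permutative : permutative sum_code.
Proof.
move=> u; split.
  have fE b : sum_code [tuple of rcons u b] = thead u + b.
    by case/tupleP: u => c u; rewrite tuple0 /sum_code !(tnth_nth ord0).
  by exists (fun c => - thead u + c) => b; rewrite fE; [rewrite addKr|rewrite addNKr].
have fE b : sum_code [tuple of b :: u] = b + thead u.
  by case/tupleP: u => c u; rewrite tuple0 /sum_code !(tnth_nth ord0).
by exists (fun c => c - thead u) => b; rewrite fE; [rewrite addrK|rewrite subrK].
Qed.

Notation hP := sum_code_permutative.

Lemma sum_code_step (a b : 'I_2) : step hP a [tuple b] = [tuple a - b].
Proof.
have := next_windowE hP [tuple b] a; rewrite /sum_code !(tnth_nth ord0) /= => ab.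
apply: eq_from_tnth => i; rewrite !(tnth_nth ord0) (ord1 i) /=.
by rewrite -[a in RHS]ab addrC addKr.
Qed.

(** The letter 1 flips the state. Among the 2 ^ n.+3 blocks of level n in a block
    of level n.+1 only the one between the two letters 1 starts in the flipped
    state. *)
Definition rare_flips (n : nat) : seq 'I_2 := nseq (2 ^ n.+3 - 3) 0 ++ [:: 1; 1].

Lemma size_rare_flips n : (size (rare_flips n)).+1 = (2 ^ n.+3)%N.
Proof.
rewrite size_cat size_nseq /=; have : (2 ^ 3 <= 2 ^ n.+3)%N by rewrite leq_exp2l.
by rewrite (_ : 2 ^ 3 = 8)%N//; lia.
Qed.

Lemma run_rare_flips n i (b : 'I_2) : (i <= size (rare_flips n))%N ->
  run hP [tuple b] (take i (rare_flips n)) =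
  if i == (2 ^ n.+3 - 2)%N then [tuple 1 - b] else [tuple b].
Proof.
have q8 : (8 <= 2 ^ n.+3)%N by rewrite (_ : 8 = 2 ^ 3)%N// leq_exp2l.
have run0 m : run hP [tuple b] (nseq m 0) = [tuple b].
  by elim: m => // m IHm; rewrite /= sum_code_step sub0r ord2_neg.
move=> is_; have := size_rare_flips n; rewrite /rare_flips in is_ *.
move: (2 ^ n.+3)%N q8 is_ => q q8; rewrite size_cat size_nseq /= => is_ qE.
have [iq|iq] := leqP i (q - 3).
  rewrite takel_cat ?size_nseq// take_nseq// run0.
  by rewrite ifF//; lia.
rewrite take_cat size_nseq ltnNge (ltnW iq) /= run_cat run0.
have [iE|iE] := eqVneq i (q - 2)%N.
  by rewrite (_ : i - (q - 3) = 1)%N /= ?sum_code_step//; lia.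
rewrite (_ : i - (q - 3) = 2)%N /= ?sum_code_step; last by lia.
by rewrite opprB addrCA subrr addr0.
Qed.

Lemma rare_flips_closed n u : run hP u (rare_flips n) = u.
Proof.
case/tupleP: u => b u; rewrite tuple0 -[rare_flips n]take_size.
have := size_rare_flips n; have : (8 <= 2 ^ n.+3)%N by rewrite (_ : 8 = 2 ^ 3)%N// leq_exp2l.
by move=> q8 sE; rewrite run_rare_flips// ifF//; lia.
Qed.

Lemma rare_flips_covers n (u v : 1.-tuple 'I_2) :
  exists2 i, (i <= size (rare_flips n))%N & run hP u (take i (rare_flips n)) = v.
Proof.
case/tupleP: u => b u; case/tupleP: v => c v; rewrite (tuple0 u) (tuple0 v).
have sE := size_rare_flips n.
have q8 : (8 <= 2 ^ n.+3)%N by rewrite (_ : 8 = 2 ^ 3)%N// leq_exp2l.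
have [->|cb] := eqVneq c b.
  by exists 0%N => //; rewrite run_rare_flips// ifF//; lia.
exists (2 ^ n.+3 - 2)%N; first by lia.
rewrite run_rare_flips ?eqxx; last by lia.
by congr [tuple _]; move: b c cb => [[|[|]]//= bi] [[|[|]]//= ci] // _; apply/val_inj.
Qed.

Definition letter_differs (b : 'I_2) : set (config 2) := [set x | x 0 <> b].

Lemma local_letter_differs b : local (letter_differs b).
Proof. by exists 1%N => x y xy; rewrite /letter_differs /= xy. Qed.

Section Frequencies.
Context (xi : config 2) (fill : fills_holes rare_flips xi).

Lemma rare_flips_ge2 n : (2 <= size (rare_flips n))%N.
Proof. by rewrite size_cat /=; lia. Qed.

(** A block of level n.+1 has at most one bad block of level n in 2 ^ n.+3, so the
    fraction of letters different from b is at most the sum of 1 / 2 ^ i.+3 over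
    i < n, which is (1 - 1 / 2 ^ n) / 4. *)
Lemma level_visits_flipped n z j (b : 'I_2) :
    sliding_block_code sum_code z = xi -> level_state rare_flips z n j = [tuple b] ->
  (4 * 2 ^ n * level_visits rare_flips (letter_differs b) z n j <=
   level_period rare_flips n * (2 ^ n - 1))%N.
Proof.
move=> zxi; elim: n j => [|n IHn] j st.
  rewrite /level_visits /visits big_ord_recl big_ord0 addn0.
  rewrite asboolF ?muln0// /letter_differs shift_iterD /shift_iter /= => -[].
  have := congr1 (fun t => tnth t ord0) st; rewrite tnth_mktuple (tnth_nth ord0) /= => <-.
  by congr z; lia.
rewrite level_visitsS.
have digit (i : 'I_(size (rare_flips n)).+1) :=
  level_state_digit fill rare_flips_closed zxi j (ltn_ord i).
have q8 : (8 <= 2 ^ n.+3)%N by rewrite (_ : 8 = 2 ^ 3)%N// leq_exp2l.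
have sE := size_rare_flips n.
have i0s : (2 ^ n.+3 - 2 < (size (rare_flips n)).+1)%N by lia.
rewrite (bigD1 (Ordinal i0s))//=; set S := (\sum_(_ < _ | _) _)%N.
have := visits_le (letter_differs b) (shift_iter (hole_class rare_flips n
  ((size (rare_flips n)).+1%:Z * j + 1 + (2 ^ n.+3 - 2)%N%:Z) + 1) z)
  (level_period rare_flips n).
rewrite -/(level_visits _ _ _ _ _).
move: (level_visits _ _ _ _ _) => B BL.
have S4 : (4 * 2 ^ n * S <= size (rare_flips n) * (level_period rare_flips n * (2 ^ n - 1)))%N.
  have -> (c : nat) : (size (rare_flips n) * c =
      \sum_(i < (size (rare_flips n)).+1 | i != Ordinal i0s) c)%N.
    by rewrite sum_nat_const cardC1 card_ord.
  rewrite /S big_distrr; apply: leq_sum => i ii0; apply: IHn.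
  rewrite digit st (run_rare_flips b (ltn_ord i)) ifF//.
  by apply/negP => /eqP ie; case/eqP: ii0; exact: val_inj.
rewrite mulnDr sE.
have qE : (2 ^ n.+3 = 8 * 2 ^ n)%N by rewrite !expnS !mulnA.
have qS : (2 ^ n.+1 = 2 * 2 ^ n)%N by rewrite expnS.
have t0 : (0 < 2 ^ n)%N by rewrite expn_gt0.
have sE' : size (rare_flips n) = (8 * 2 ^ n - 1)%N by lia.
rewrite sE' in S4; rewrite qE qS.
move: (2 ^ n)%N (level_period rare_flips n) t0 BL S4 => t L t0 BL S4.
have B4 : (4 * (2 * t) * B <= 8 * t * L)%N.
  by rewrite mulnA (_ : 4 * 2 = 8)%N// leq_mul2l BL orbT.
have S8 : (4 * (2 * t) * S <= 2 * ((8 * t - 1) * (L * (t - 1))))%N.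
  by rewrite (_ : 4 * (2 * t) * S = 2 * (4 * t * S))%N ?leq_mul2l ?S4 ?orbT// !mulnA.
apply: leq_trans (leq_add B4 S8) _.
case: t t0 {BL S4 B4 S8} => // t _; rewrite !subn1 /=.
by nia.
Qed.

Local Notation X := (sliding_block_code sum_code @^-1` language_subshift xi).

Lemma sparse_measure (R : realType) (b : 'I_2) :
  exists mu : probability (borel_config 1) R, invariant_probability X mu /\
    (mu (letter_differs b) <= (4^-1 : R)%:E)%E.
Proof.
have cX : closed X by apply: closed_sliding_preimage; exact: closed_language_subshift.
pose i0 n := hole_class rare_flips n 0 + 1.
have /choice[z zP] : forall n, exists z, sliding_block_code sum_code z = xi /\
    window z (i0 n) 1 = [tuple b].
  by move=> n; have [z ? ?] := lift_exists hP xi (i0 n) [tuple b]; exists z.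
have [n t|n|mu [imu muC]] := @krylov_bogoliubov R 1 X
  (fun n => shift_iter (i0 n) (z n)) (level_period rare_flips) cX.
- rewrite /preimage /= !sliding_shift (zP n).1.
  by do 2 apply: language_subshift_shift.
- by have [] := level_hole_bounds rare_flips_ge2 n; lia.
exists mu; split=> //; apply: muC => [|n]; first exact: local_letter_differs.
have L0 := level_period_gt0 rare_flips n.
rewrite ler_pdivrMr ?ltr0n//.
have := level_visits_flipped (zP n).1 (zP n).2.
rewrite /level_visits -/(i0 n); set V := visits _ _ _ => VL.
have : (4 * V <= level_period rare_flips n)%N.
  rewrite -(@leq_pmul2l (2 ^ n)) ?expn_gt0// mulnA [(2 ^ n * 4)%N]mulnC (leq_trans VL)//.
  by rewrite mulnC leq_mul2r leq_subr orbT.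
by rewrite -(ler_nat R) natrM; lra.
Qed.

(** The measures obtained from the two states give mass at most 1 / 4 to
    complementary sets. *)
Lemma sum_code_not_uniquely_ergodic (R : realType) : ~ uniquely_ergodic R X.
Proof.
case=> mu _ uniq.
have [mu0 [i0 mu0C]] := sparse_measure R 0.
have [mu1 [i1 mu1C]] := sparse_measure R 1.
have mC b : @measurable _ (borel_config 1) (letter_differs b).
  exact: (local_measurable (local_letter_differs b)).
rewrite uniq// in mu0C; rewrite uniq// in mu1C.
have : (mu setT <= mu (letter_differs 0%R) + mu (letter_differs 1%R))%E.
  apply: le_trans (measureU2 _ (mC 0) (mC 1)).
  apply: le_measure; rewrite ?inE//; first exact: measurableU.
  move=> x _; have [x0|x0] := eqVneq (x 0) (0 : 'I_2); last by left; apply/eqP.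
  by right; rewrite /letter_differs /mkset (x0 : x 0 = 0).
rewrite probability_setT; apply/negP; rewrite -ltNge.
apply: le_lt_trans (leeD mu0C mu1C) _.
by rewrite -EFinD lte_fin; lra.
Qed.

End Frequencies.
End SumCode.

Lemma exists_minimal_not_uniquely_ergodic (R : realType) :
  exists (k l : nat) (Y : set (config k.+1)) (h : block_code k.+1 l.+1),
    [/\ regular_toeplitz_subshift R Y, permutative h,
        minimal (sliding_block_code h @^-1` Y) &
        ~ uniquely_ergodic R (sliding_block_code h @^-1` Y)].
Proof.
have [xi fill] := fills_holes_exists rare_flips.
exists 1%N, 1%N, (language_subshift xi), sum_code; split.
- apply: (fills_holes_regular R rare_flips_ge2 fill) => n.
  have q8 : (8 <= 2 ^ n.+3)%N by rewrite (_ : 8 = 2 ^ 3)%N// leq_exp2l.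
  have sE := size_rare_flips n.
  exists 0%N, (2 ^ n.+3 - 3)%N; split; [lia|lia|].
  rewrite !nth_cat size_nseq ltnn subnn /= ifT; last by lia.
  by rewrite nth_nseq; case: ifP.
- exact: sum_code_permutative.
- exact: (preimage_minimal rare_flips_ge2 fill rare_flips_closed rare_flips_covers).
- exact: sum_code_not_uniquely_ergodic.
Qed.

Theorem theorem1p9 (R : realType) :
  (* kappa = k + 2 >= 2 and ell = l + 1 >= 1 *)
  (forall (k l : nat) (h : block_code k.+2 l.+1), permutative h ->
     exists2 Y : set (config k.+2), regular_toeplitz_subshift R Y &
       strictly_ergodic R (sliding_block_code h @^-1` Y)) /\
  (* kappa = k + 2 >= 2 and ell = l + 2 >= 2 *)
  (forall (k l : nat) (h : block_code k.+2 l.+2), permutative h ->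
     exists2 Y : set (config k.+2), regular_toeplitz_subshift R Y &
       ~ minimal (sliding_block_code h @^-1` Y)) /\
  (* kappa = k + 1 >= 1 and ell = l + 1 >= 1 *)
  (forall (k : nat) (Y : set (config k.+1)), toeplitz_subshift Y ->
     exists (l : nat) (h : block_code k.+1 l.+1),
       permutative h /\ ~ minimal (sliding_block_code h @^-1` Y)) /\
  (exists (k l : nat) (Y : set (config k.+1)) (h : block_code k.+1 l.+1),
     [/\ regular_toeplitz_subshift R Y, permutative h,
         minimal (sliding_block_code h @^-1` Y) &
         ~ uniquely_ergodic R (sliding_block_code h @^-1` Y)]).
Proof.
split=> [k l h|]; first exact: exists_strictly_ergodic_preimage.
split=> [k l h|]; first exact: exists_not_minimal_preimage.
split=> [k Y|]; first exact: toeplitz_subshift_not_minimal_preimage.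
exact: exists_minimal_not_uniquely_ergodic.
Qed.
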